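(* Let $n\ge 1$, $\sigma\in(0,1)$ and $p\in(0,\infty)$ be such that $\sigma p>1$. Then there exists a positive constant $C$ depending only on $n$, $\sigma$ and $p$ such that for all open sets $\Omega\subset\mathbb{R}^n$ and all nonnegative $u\in C_c^\infty(\Omega)$, $$\iint_{\mathbb{R}^n\times\mathbb{R}^n}\frac{|u^*(x)-u^*(y)|^p}{|x-y|^{n+\sigma p}}\,dx\,dy\le C\iint_{\Omega\times\Omega}\frac{|u(x)-u(y)|^p}{|x-y|^{n+\sigma p}}\,dx\,dy.$$ In particular, $$\iint_{\Omega^*\times\Omega^*}\frac{|u^*(x)-u^*(y)|^p}{|x-y|^{n+\sigma p}}\,dx\,dy\le C\iint_{\Omega\times\Omega}\frac{|u(x)-u(y)|^p}{|x-y|^{n+\sigma p}}\,dx\,dy.$$ Here $\Omega^*$ is the symmetric rearrangement of $\Omega$ and $u^*$ is the symmetric decreasing rearrangement of $u$.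
   Context: $|A|$ denotes the Lebesgue measure of $A\subset\mathbb{R}^n$, and $\alpha_n=\pi^{n/2}/\Gamma(\frac n2+1)$ is the volume of the unit ball of $\mathbb{R}^n$. For a Borel set $A\subset\mathbb{R}^n$ with $|A|<\infty$, its symmetric rearrangement is the open ball $A^*=\{x\in\mathbb{R}^n: |x|<(|A|/\alpha_n)^{1/n}\}$ (with $A^*=\varnothing$ if $|A|=0$); if $|A|=\infty$, set $A^*=\mathbb{R}^n$. $\chi_E$ denotes the indicator function of $E$, with $\chi_\varnothing\equiv 0$. For a Borel measurable $u:\mathbb{R}^n\to\mathbb{R}$ such that $|\{|u|>t\}|<\infty$ for all $t>0$, its symmetric decreasing rearrangement is $$u^*(x)=\int_0^\infty\chi_{\{|u|>t\}^*}(x)\,dt.$$ $C_c^\infty(\Omega)$ is the space of smooth real-valued functions with compact support in $\Omega$; such functions are extended by zero to all of $\mathbb{R}^n$. *)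

(* Defs.v *)
From HB Require Import structures.
From mathcomp Require Import all_boot all_order all_algebra.
From mathcomp Require Import all_classical all_reals all_analysis.
From mathcomp Require Import measurable_realfun.

Set Implicit Arguments.
Unset Strict Implicit.
Unset Printing Implicit Defensive.

Import Order.TTheory GRing.Theory Num.Theory.
Import numFieldNormedType.Exports.

Local Open Scope classical_set_scope.
Local Open Scope ring_scope.

(* R^n is 'rV[R]_n with its library topology, equipped with the Borel
   sigma-algebra.  The library norm `|x| on 'rV[R]_n is the sup norm, hence
   the separate Euclidean norm [enorm] below. *)
Definition borel_rV_display : measure_display. Proof. exact. Qed.

Section borel_rV.
Variables (R : realType) (n : nat).

HB.instance Definition _ := @isMeasurable.Build borel_rV_display 'rV[R]_n
  <<s @open 'rV[R]_n >> (@sigma_algebra0 _ setT (@open 'rV[R]_n))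
  (@sigma_algebraC 'rV[R]_n (@open 'rV[R]_n))
  (@sigma_algebra_bigcup _ setT (@open 'rV[R]_n)).

Lemma measurable_rVE : @measurable _ 'rV[R]_n = <<s @open 'rV[R]_n >>.
Proof. by []. Qed.

Lemma open_measurable_rV (A : set 'rV[R]_n) : open A -> measurable A.
Proof. by move=> oA; exact: sub_sigma_algebra. Qed.

Lemma continuous_measurable_rV (f : 'rV[R]_n -> R) :
  continuous f -> measurable_fun [set: 'rV[R]_n] f.
Proof.
move=> /continuousP cf; apply: (measurability _ (RGenOpens.measurableE R)).
move=> _ [_ [a [b ->] <-]]; rewrite setTI; apply: open_measurable_rV.
exact/cf/interval_open.
Qed.

Lemma measurable_fun_rVP d (T : measurableType d) (f : T -> 'rV[R]_n) :
  measurable_fun [set: T] f <->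
  forall i, measurable_fun [set: T] (fun x => f x ord0 i).
Proof.
split=> [mf i|mf].
  apply: (@measurableT_comp _ _ _ _ _ _ (fun x : 'rV[R]_n => x ord0 i)) => //.
  by apply: continuous_measurable_rV; exact: coord_continuous.
apply: (measurability _ measurable_rVE) => _ [U oU <-]; rewrite setTI.
pose c (q : 'rV[rat]_n) : 'rV[R]_n := \row_i ratr (q ord0 i).
pose D : set ('rV[rat]_n * nat) :=
  [set q | ball (c q.1) q.2.+1%:R^-1 `<=` U].
have -> : f @^-1` U = \bigcup_(q in D) f @^-1` ball (c q.1) q.2.+1%:R^-1.
  apply/seteqP; split=> [x /= Ufx|x [q Dq] /Dq//].
  have /nbhs_ballP[e /= e0 eU] : nbhs (f x) U by exact: open_nbhs_nbhs.
  have e20 : 0 < e / 2 by rewrite divr_gt0.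
  have [k ke] : exists k : nat, k.+1%:R^-1 < e / 2.
    exact: filter_ex (near_infty_natSinv_lt (PosNum e20)).
  have /choice[q qP] : forall i, exists q : rat,
      ball (f x ord0 i) k.+1%:R^-1 (ratr q).
    move=> i; have [] := @dense_rat R (ball (f x ord0 i) k.+1%:R^-1).
    - by exists (f x ord0 i); apply: ballxx; rewrite invr_gt0.
    - exact: ball_open.
    - by move=> y [fy [q _ qy]]; exists q; rewrite qy.
  exists (\row_i q i, k).
    move=> y /= [_ cy]; apply: eU; split=> // i j.
    have -> : i = ord0 by exact: ord1.
    rewrite (splitr e); apply: (@ball_triangle _ _ (ratr (q j) : R)).
      exact: le_ball (ltW ke) _ (qP j).
    by apply: le_ball (ltW ke) _ _; have := cy ord0 j; rewrite !mxE.
  split=> [|i j]; first by rewrite invr_gt0.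
  by rewrite (ord1 i) !mxE; apply/ball_sym/qP.
rewrite bigcup_mkcond; apply: countable_bigcupT_measurable => // q.
case: ifPn => // _.
have -> : f @^-1` ball (c q.1) q.2.+1%:R^-1 = \bigcap_(i in [set: 'I_n])
    (fun x => f x ord0 i) @^-1` ball (c q.1 ord0 i) q.2.+1%:R^-1.
  apply/seteqP; split=> [x /= [_ fx] i _|x /= fx]; first exact: fx.
  split=> [|i j]; first by rewrite invr_gt0.
  by rewrite (ord1 i); exact: fx.
apply: fin_bigcap_measurable => // i _.
rewrite -[X in measurable X]setTI; apply: mf => //.
by apply: open_measurable; exact: ball_open.
Qed.
End borel_rV.

(* The library also proves this, but its instance is shadowed by the one for
   products of subprobabilities and cannot be inferred. *)
Lemma product_sigma_finite d1 d2 (T1 : measurableType d1)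
    (T2 : measurableType d2) (R : realType)
    (m1 : {sigma_finite_measure set T1 -> \bar R})
    (m2 : {sigma_finite_measure set T2 -> \bar R}) :
  sigma_finite setT (m1 \x m2)%E.
Proof.
have /sigma_finiteP[F [TF ndF Foo]] := sigma_finiteT m1.
have /sigma_finiteP[G [TG ndG Goo]] := sigma_finiteT m2.
exists (fun n => F n `*` G n).
  rewrite -setXTT TF TG predeqE => -[x y]; split.
    move=> [/= [n _ Fnx] [k _ Gky]]; exists (maxn n k) => //; split.
    - by move: x Fnx; exact/subsetPset/ndF/leq_maxl.
    - by move: y Gky; exact/subsetPset/ndG/leq_maxr.
  by move=> [n _ []/= ? ?]; split; exists n.
move=> k; have [? ?] := Foo k; have [? ?] := Goo k.
split; first exact: measurableX.
by rewrite product_measure1E// lte_mul_pinfty// ge0_fin_numE.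
Qed.

Section lebesgue_rV_step.
Variables (R : realType) (n : nat).
Variable mu : {sigma_finite_measure set 'rV[R]_n -> \bar R}.

Definition cons_rV (z : R * 'rV[R]_n) : 'rV[R]_n.+1 :=
  \row_i (if unlift ord0 i is Some j then z.2 ord0 j else z.1).

Lemma cons_rV0 z : cons_rV z ord0 ord0 = z.1.
Proof. by rewrite mxE unlift_none. Qed.

Lemma cons_rVS z i : cons_rV z ord0 (lift ord0 i) = z.2 ord0 i.
Proof. by rewrite mxE liftK. Qed.

Definition uncons_rV (x : 'rV[R]_n.+1) : R * 'rV[R]_n :=
  (x ord0 ord0, \row_i x ord0 (lift ord0 i)).

Lemma cons_rVK : cancel cons_rV uncons_rV.
Proof.
move=> [a x]; rewrite /uncons_rV cons_rV0/=; congr pair.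
by apply/rowP => i; rewrite mxE cons_rVS.
Qed.

Lemma uncons_rVK : cancel uncons_rV cons_rV.
Proof.
move=> x; apply/rowP => i; case: (unliftP ord0 i) => [j|] ->.
  by rewrite cons_rVS mxE.
by rewrite cons_rV0.
Qed.

Lemma measurable_cons_rV : measurable_fun setT cons_rV.
Proof.
apply/measurable_fun_rVP => i; case: (unliftP ord0 i) => [j|] ->.
  under eq_fun do rewrite cons_rVS.
  apply: (@measurableT_comp _ _ _ _ _ _ (fun x : 'rV[R]_n => x ord0 j)) => //.
  by apply: continuous_measurable_rV; exact: coord_continuous.
under eq_fun do rewrite cons_rV0.
exact: measurable_fst.
Qed.

Lemma measurable_uncons_rV : measurable_fun setT uncons_rV.
Proof.
rewrite /uncons_rV; apply: measurable_fun_pair.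
  by apply: continuous_measurable_rV; exact: coord_continuous.
apply/measurable_fun_rVP => i; under eq_fun do rewrite mxE.
by apply: continuous_measurable_rV; exact: coord_continuous.
Qed.

Definition lebesgue_rV_step : set 'rV[R]_n.+1 -> \bar R :=
  pushforward (lebesgue_measure \x mu)%E cons_rV.

Let step0 : lebesgue_rV_step set0 = 0%E.
Proof. by rewrite /lebesgue_rV_step /pushforward preimage_set0 measure0. Qed.

Let step_ge0 A : (0 <= lebesgue_rV_step A)%E.
Proof. by rewrite /lebesgue_rV_step /pushforward measure_ge0. Qed.

Let step_sigma_additive : semi_sigma_additive lebesgue_rV_step.
Proof.
move=> F mF tF mUF; rewrite /lebesgue_rV_step /pushforward preimage_bigcup.
have mpre A : measurable A -> measurable (cons_rV @^-1` A).
  by move=> mA; rewrite -[X in measurable X]setTI; exact: measurable_cons_rV.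
apply: measure_semi_sigma_additive => [k||]; first exact: mpre.
- apply/trivIsetP => i j _ _ ij; rewrite -preimage_setI.
  by move/trivIsetP : tF => /(_ _ _ _ _ ij) ->//; rewrite preimage_set0.
- by rewrite -preimage_bigcup; exact: mpre.
Qed.

HB.instance Definition _ := isMeasure.Build _ _ _ lebesgue_rV_step
  step0 step_ge0 step_sigma_additive.

Let sigma_finite_step : sigma_finite setT lebesgue_rV_step.
Proof.
have [F FT mF] := product_sigma_finite (@lebesgue_measure R) mu.
exists (fun k => uncons_rV @^-1` F k) => [|k].
  by rewrite -preimage_bigcup -FT preimage_setT.
have [mFk Fk] := mF k; split.
  by rewrite -[X in measurable X]setTI; exact: measurable_uncons_rV.
rewrite /lebesgue_rV_step /pushforward -comp_preimage.
by rewrite (_ : _ \o _ = id) ?preimage_id//; apply/funext => z; exact: cons_rVK.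
Qed.

HB.instance Definition _ := Measure_isSigmaFinite.Build _ _ _ lebesgue_rV_step
  sigma_finite_step.
End lebesgue_rV_step.

Fixpoint lebesgue_rV (R : realType) (n : nat) :
    {sigma_finite_measure set 'rV[R]_n -> \bar R} :=
  if n is m.+1 then lebesgue_rV_step (lebesgue_rV R m)
  else \d_(0 : 'rV[R]_0).

Lemma lebesgue_rV_box (R : realType) (n : nat) (A : 'I_n -> set R) :
  (forall i, measurable (A i)) ->
  lebesgue_rV R n [set x | forall i, A i (x ord0 i)] =
  (\prod_(i < n) lebesgue_measure (A i))%E.
Proof.
elim: n => [|n IHn] in A *.
  move=> _; rewrite big_ord0 /lebesgue_rV /= /dirac indicE mem_set//.
  by case.
move=> mA; rewrite big_ord_recl/= /lebesgue_rV_step /pushforward.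
set B : set 'rV[R]_n := [set x | forall i, A (lift ord0 i) (x ord0 i)].
rewrite [X in (lebesgue_measure \x _)%E X](_ : _ = A ord0 `*` B); last first.
  apply/seteqP; split=> [z /= Az|z /= [A0 AS] i].
    split=> [|i]; first by have := Az ord0; rewrite cons_rV0.
    by have := Az (lift ord0 i); rewrite cons_rVS.
  by case: (unliftP ord0 i) => [j|] ->; rewrite ?cons_rV0 ?cons_rVS.
have mB : measurable B.
  have -> : B = \bigcap_(i in [set: 'I_n])
      (fun x : 'rV[R]_n => x ord0 i) @^-1` A (lift ord0 i).
    by apply/seteqP; split=> [x Bx i _|x Bx i]; exact: Bx.
  apply: fin_bigcap_measurable => // i _; rewrite -[X in measurable X]setTI.
  apply: (@continuous_measurable_rV R n (fun x => x ord0 i)) => //.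
  exact: coord_continuous.
rewrite product_measure1E//; last exact: mA.
by rewrite (IHn (fun i => A (lift ord0 i))).
Qed.

Section rearrangement.
Variable R : realType.
Implicit Types (n : nat) (s p : R).

Definition enorm n (x : 'rV[R]_n) : R := Num.sqrt (\sum_(i < n) x ord0 i ^+ 2).

Definition Gamma (s : R) : R :=
  \int[lebesgue_measure]_(t in `]0, +oo[) (t `^ (s - 1) * expR (- t)).

Definition unit_ball_volume n : R :=
  pi `^ (n%:R / 2) / Gamma (n%:R / 2 + 1).

Definition symm_set n (A : set 'rV[R]_n) : set 'rV[R]_n :=
  if lebesgue_rV R n A == +oo%E then [set: 'rV[R]_n] else
  [set x | enorm x <
    (fine (lebesgue_rV R n A) / unit_ball_volume n) `^ n%:R^-1].

(* The integral is read in R; it is finite whenever u is bounded and has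
   superlevel sets of finite measure. *)
Definition symm_fun n (u : 'rV[R]_n -> R) (x : 'rV[R]_n) : R :=
  \int[lebesgue_measure]_(t in `]0, +oo[)
    \1_(symm_set [set y | t < `|u y|]) x.

Definition gagliardo n s p (D : set 'rV[R]_n) (u : 'rV[R]_n -> R) : \bar R :=
  (\int[lebesgue_rV R n \x lebesgue_rV R n]_(z in D `*` D)
    (`|u z.1 - u z.2| `^ p / enorm (z.1 - z.2) `^ (n%:R + s * p))%:E)%E.

Fixpoint iter_partial n (l : seq 'I_n) (u : 'rV[R]_n -> R) : 'rV[R]_n -> R :=
  if l is i :: l' then 'D_(delta_mx ord0 i) (iter_partial l' u) else u.

Definition smooth n (u : 'rV[R]_n -> R) : Prop :=
  forall l : seq 'I_n, continuous (iter_partial l u) /\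
    forall i x, derivable (iter_partial l u) x (delta_mx ord0 i).

(* C_c^oo(Omega), each function being identified with its extension by zero. *)
Definition Cc_smooth n (Omega : set 'rV[R]_n) : set ('rV[R]_n -> R) :=
  [set u | [/\ smooth u, compact (closure [set x | u x != 0]) &
               closure [set x | u x != 0] `<=` Omega]].

End rearrangement.

(* Main.v *)
(* Write al = sigma p > 1 and b = n + al.  The constant being free, no sharp
   rearrangement inequality is needed.

   From Omega to R^n: the energy on R^n exceeds the one on Omega x Omega by
   twice the integral X of u(x)^p |h|^(-b) over x + h outside Omega.  If x + 2h
   is outside Omega, either x + h is too, or u(x) differs little from u(x + h),
   x + h being one step h away from the complement.  Dilating h by 2 therefore
   gives X <= 2^(-al) ((2 + e) X + D E), with E the energy on Omega x Omega.
   Since al > 1, X is absorbed for small e; it is finite because the support of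
   u lies at positive distance from the complement of Omega.

   Rearrangement on R^n: for A included in E, let G(rho; A, E) be the measure of
   the pairs x in A, y not in E with |x - y| < rho.  The measure of the x in A
   that a translation moves out of A is subadditive in the translation, so
   averaging over cubes yields a crude isoperimetric bound, and an explicit
   computation for the balls A', E' rearranging A, E gives
   G(rho; A', E') <= C G(L rho; A, E) for all rho.  Summing over
   rho = 2^k turns this into a bound for the kernel |x - y|^(-b), and a discrete
   layer-cake formula for |u(x) - u(y)|^p (which needs p > 1) turns it into the
   bound for u. *)

Require Import Defs.
From HB Require Import structures.
From mathcomp Require Import all_boot all_order all_algebra.
From mathcomp Require Import all_classical all_reals all_analysis.
From mathcomp Require Import measurable_realfun ring lra.

Import Order.TTheory GRing.Theory Num.Theory.
Import numFieldNormedType.Exports.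

Local Open Scope classical_set_scope.
Local Open Scope ring_scope.

Set Implicit Arguments.
Unset Strict Implicit.
Unset Printing Implicit Defensive.

(** * Measurability of preimages and superlevel sets *)

Lemma measurable_preimage d d' (T : measurableType d) (U : measurableType d')
    (f : T -> U) (A : set U) :
  measurable_fun setT f -> measurable A -> measurable (f @^-1` A).
Proof. by move=> mf mA; rewrite -[X in measurable X]setTI; exact: mf. Qed.

Lemma measurable_superlevel d (T : measurableType d) (R : realType)
    (u : T -> R) (t : R) :
  measurable_fun setT u -> measurable [set x | t < u x].
Proof.
move=> mu; rewrite (_ : [set x | _] = u @^-1` `]t, +oo[%classic).
  exact: measurable_preimage.
by apply/seteqP; split=> x /=; rewrite in_itv/= andbT.
Qed.

(** * Lebesgue measure on row vectors *)

Section change_of_variables.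
Variable R : realType.

Lemma ge0_integral_comp_scale d d' (T : measurableType d)
    (U : measurableType d') (m : {measure set T -> \bar R})
    (m' : {measure set U -> \bar R}) (phi : T -> U) (k : R) :
  0 <= k -> measurable_fun setT phi ->
  (forall A, measurable A -> m (phi @^-1` A) = k%:E * m' A)%E ->
  forall f : U -> \bar R, measurable_fun setT f -> (forall x, 0 <= f x)%E ->
  (\int[m]_x f (phi x) = k%:E * \int[m']_x f x)%E.
Proof.
move=> k0 mphi phiE f mf f0.
rewrite -(@ge0_integral_mscale _ _ _ m' setT measurableT (NngNum k0))//.
rewrite -(@ge0_integral_pushforward _ _ _ _ _ phi mphi m setT f)//.
by apply: eq_measure_integral => A mA _; rewrite /= /pushforward phiE.
Qed.

Lemma measurable_affine (c b : R) : measurable_fun setT (fun t : R => c * t + b).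
Proof. by apply: measurable_funD => //; apply: measurable_funM. Qed.

(** [c] times the image of Lebesgue measure under the affine map agrees with Lebesgue measure on
    half-open intervals, hence everywhere by uniqueness. *)
Lemma lebesgue_measure_affine (c b : R) (A : set R) : 0 < c -> measurable A ->
  lebesgue_measure ((fun t => c * t + b) @^-1` A) =
  ((c^-1)%:E * lebesgue_measure A)%E.
Proof.
move=> c0 mA; have mf := measurable_affine c b.
suff -> : lebesgue_measure A = pushforward (mscale (NngNum (ltW c0))
    lebesgue_measure)
    ((fun t => c * t + b) : R -> measurableTypeR R) A.
  by rewrite /mscale/= /pushforward muleA -EFinM mulVf ?gt_eqF// mul1e.
apply: lebesgue_measure_unique => // _ [[x y] /= xy <-].
rewrite /mscale/= /pushforward.
have -> : (fun t : R => c * t + b) @^-1` `]x, y] = `](x - b) / c, (y - b) /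
    c]%classic.
  by apply/seteqP; split=> t /=; rewrite !in_itv/= ltr_pdivrMr// ler_pdivlMr//;
    rewrite ltrBlDr lerBrDr mulrC.
rewrite !lebesgue_measure_itv/= !lte_fin ltr_pM2r ?invr_gt0// ltrD2r.
case: ifP => _; last by rewrite mule0.
by rewrite -!EFinD -EFinM; congr (_%:E); field; rewrite gt_eqF.
Qed.

Lemma measurable_rV_affine n (c : R) (b : 'rV[R]_n) :
  measurable_fun setT (fun x : 'rV[R]_n => c *: x + b).
Proof.
apply/measurable_fun_rVP => i.
under eq_fun do rewrite !mxE.
apply: measurable_funD => //; apply: measurable_funM => //.
by apply: continuous_measurable_rV; exact: coord_continuous.
Qed.

(** Induction on the dimension through [cons_rV]: the slice at [t] of the preimage is the
    lower-dimensional preimage of the slice at [c * t + b0]. The induction hypothesis gives [c^-n]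
    and the outer one-dimensional integral the last factor [c^-1]. *)
Lemma lebesgue_rV_affine n (c : R) (b : 'rV[R]_n) (A : set 'rV[R]_n) :
  0 < c -> measurable A ->
  lebesgue_rV R n ((fun x => c *: x + b) @^-1` A) =
  ((c^-1 ^+ n)%:E * lebesgue_rV R n A)%E.
Proof.
move=> c0; elim: n => [|n IHn] in b A *.
  move=> mA; rewrite expr0 mul1e /=; congr (dirac _ _ ); apply/seteqP; split => x /=;
  by rewrite (_ : c *: x + b = x)//; apply/rowP => -[].
move=> mA.
have mcA : measurable (@cons_rV R n @^-1` A).
  by apply: measurable_preimage => //; exact: measurable_cons_rV.
pose b' : 'rV[R]_n := \row_i b ord0 (lift ord0 i).
pose b0 := b ord0 ord0.
have Scons t x : c *: cons_rV (t, x) + b = cons_rV (c * t + b0, c *: x + b').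
  apply/rowP => i; rewrite !mxE; case: unliftP => [j ->|->] //=.
  by rewrite !mxE.
pose g t := lebesgue_rV R n (xsection (@cons_rV R n @^-1` A) t).
have mg : measurable_fun setT g by exact: measurable_fun_xsection.
have gE t : (lebesgue_rV R n (xsection (@cons_rV R n @^-1`
     ((fun x : 'rV[R]_n.+1 => c *: x + b)%R @^-1` A)) t) = (c^-1 ^+ n)%:E * g
         (c * t + b0)%R)%E.
  rewrite -(IHn b'); last exact: measurable_xsection.
  congr (lebesgue_rV R n _); apply/seteqP; split=> x;
  by rewrite /xsection/= !inE /= Scons.
rewrite /= /lebesgue_rV_step /pushforward /product_measure1.
rewrite [LHS](_ : _ = \int[lebesgue_measure]_t ((c^-1 ^+ n)%:E * g (c * t +
    b0)%R))%E; last first.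
  by apply: eq_integral => t _; exact: gE.
have cn0 : 0 <= c^-1 ^+ n by rewrite exprn_ge0// invr_ge0 ltW.
rewrite ge0_integralZl_EFin//; last first.
  by apply: (measurableT_comp mg); exact: measurable_affine.
rewrite exprSr EFinM -muleA; congr (_ * _)%E.
apply: (@ge0_integral_comp_scale _ _ _ _ lebesgue_measure lebesgue_measure
  (fun t => c * t + b0)) => //.
- by rewrite invr_ge0 ltW.
- exact: measurable_affine.
- by move=> B mB; exact: lebesgue_measure_affine.
Qed.

Lemma ge0_integral_rV_affine n (c : R) (b : 'rV[R]_n) (f : 'rV[R]_n -> \bar R) :
  0 < c -> measurable_fun setT f -> (forall x, 0 <= f x)%E ->
  (\int[lebesgue_rV R n]_x f (c *: x + b)%R =
   (c^-1 ^+ n)%:E * \int[lebesgue_rV R n]_x f x)%E.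
Proof.
move=> c0 mf f0; apply: (@ge0_integral_comp_scale _ _ _ _ (lebesgue_rV R n)
  (lebesgue_rV R n) (fun x => c *: x + b)) => //.
- by rewrite exprn_ge0// invr_ge0 ltW.
- exact: measurable_rV_affine.
- by move=> B mB; exact: lebesgue_rV_affine.
Qed.

End change_of_variables.

(** * Series over dyadic scales *)

Section integer_series.
Local Open Scope ereal_scope.
Variable R : realType.
Implicit Types f g : int -> \bar R.

(** The sum over all integers as one series: [Negz m] is [-(m + 1)], so each integer occurs exactly
    once. *)
Definition zsum f : \bar R := \sum_(m <oo) (f (Posz m) + f (Negz m)).

Lemma zsum_ge0 f : (forall k, 0 <= f k) -> 0 <= zsum f.
Proof. by move=> f0; apply: nneseries_ge0 => m _ _; exact: adde_ge0. Qed.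

Lemma le_zsum f g : (forall k, 0 <= f k) -> (forall k, f k <= g k) ->
  zsum f <= zsum g.
Proof.
by move=> f0 fg; apply: lee_nneseries => m _; rewrite ?adde_ge0 ?leeD.
Qed.

Lemma eq_zsum f g : f =1 g -> zsum f = zsum g.
Proof. by move=> fg; apply: eq_eseriesr => m _; rewrite !fg. Qed.

Lemma zsum_term f k : (forall k, 0 <= f k) -> f k <= zsum f.
Proof.
move=> f0.
have H m : f (Posz m) + f (Negz m) <= zsum f.
  apply: (@le_trans _ _ (\sum_(0 <= i < m.+1) (f (Posz i) + f (Negz i)))).
    by rewrite big_nat_recr//= leeDr// sume_ge0// => i _; exact: adde_ge0.
  by apply: nneseries_lim_ge => i _ _; exact: adde_ge0.
case: k => m; apply: (le_trans _ (H m)); first by rewrite leeDl.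
by rewrite leeDr.
Qed.

Lemma zsumZl (c : R) f : (forall k, 0 <= f k) ->
  zsum (fun k => c%:E * f k) = c%:E * zsum f.
Proof.
move=> f0; rewrite /zsum -nneseriesZl//; last by move=> i _; exact: adde_ge0.
by apply: eq_eseriesr => m _; rewrite ge0_muleDr.
Qed.

Lemma integral_zsum d (T : measurableType d) (mu : {measure set T -> \bar R})
    (f : int -> T -> \bar R) :
  (forall k, measurable_fun setT (f k)) -> (forall k x, 0 <= f k x) ->
  \int[mu]_x zsum (f ^~ x) = zsum (fun k => \int[mu]_x f k x).
Proof.
move=> mf f0; rewrite /zsum integral_nneseries//.
- by apply: eq_eseriesr => m _; rewrite ge0_integralD.
- by move=> m; exact: emeasurable_funD.
- by move=> m x _; exact: adde_ge0.
Qed.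

Lemma measurable_zsum d (T : measurableType d) (f : int -> T -> \bar R) :
  (forall k, measurable_fun setT (f k)) -> (forall k x, 0 <= f k x) ->
  measurable_fun setT (fun x => zsum (f ^~ x)).
Proof.
move=> mf f0; apply: ge0_emeasurable_sum => [m x _ _|m _]; first exact: adde_ge0.
exact: emeasurable_funD.
Qed.

(** The first [M] terms run over the integers from [-M] to [M - 1] and telescope to at most
    [g (-M) - g M]. *)
Lemma zsum_telescope (f g : int -> R) (B : R) :
  (forall k, 0 <= f k <= g k - g (k + 1))%R -> (forall k, 0 <= g k <= B)%R ->
  zsum (EFin \o f) <= B%:E.
Proof.
move=> fg g0; apply: lime_le.
  by apply: is_cvg_nneseries => m _ _ /=; rewrite adde_ge0// lee_fin;
    have /andP[] := fg m; have /andP[] := fg (Negz m).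
apply: nearW => M /=.
rewrite (@le_trans _ _ (g (- M%:Z) - g M%:Z)%R%:E)//; last first.
  by rewrite lee_fin; have /andP[_ ?] := g0 (- M%:Z)%R;
      have /andP[? _] := g0 M%:Z; lra.
elim: M => [|M IH]; first by rewrite big_geq// subrr.
rewrite big_nat_recr//= (le_trans (leeD IH (lexx _)))//.
rewrite -!EFinD lee_fin.
have /andP[_ ] := fg M%:Z; have /andP[_] := fg (Negz M).
rewrite NegzE (_ : - M.+1%:Z + 1 = - M%:Z)%R; last by rewrite -addn1 PoszD; ring.
rewrite (_ : M%:Z + 1 = M.+1%:Z)%R; last by rewrite -addn1 PoszD.
lra.
Qed.

End integer_series.

Section dyadic_scales.
Variable R : realType.
Implicit Types d beta : R.

Definition dyad (k : int) : R := 2 `^ k%:~R.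

Lemma dyad_gt0 k : (0 < dyad k). Proof. by rewrite powR_gt0. Qed.

Lemma dyadS k : dyad (k + 1) = (2 * dyad k).
Proof. by rewrite /dyad intrD mulr1z powRD ?pnatr_eq0 ?implybT// powRr1// mulrC. Qed.

Lemma dyad_leS k : dyad k <= dyad (k + 1).
Proof. by rewrite dyadS ler_peMl ?ler1n// ltW// dyad_gt0. Qed.

Lemma le_powRN beta (s t : R) :
  0 <= beta -> 0 < s -> s <= t -> t `^ (- beta) <= s `^ (- beta).
Proof.
move=> b0 s0 st; have t0 := lt_le_trans s0 st.
rewrite !powRN lef_pV2 ?posrE ?powR_gt0//.
by apply: ge0_ler_powR => //; rewrite ?nnegrE; exact: ltW.
Qed.

Lemma geometric_const_gt0 beta : 0 < beta -> 0 < (1 - 2 `^ (- beta))^-1 :> R.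
Proof.
move=> b0; rewrite invr_gt0 subr_gt0 powRN invf_lt1 ?powR_gt0//.
have := @gt0_ltr_powR R beta b0 1 2; rewrite powR1; apply;
  by rewrite ?nnegrE ?ltr1n.
Qed.

Lemma ex_dyad (d : R) : (0 < d) -> exists k, (dyad k <= d < dyad (k + 1)).
Proof.
move=> d0; exists (Num.floor (ln d / ln 2)).
have l2 : (0 < ln (2 : R)) by rewrite ln_gt0 ?ltr1n.
have dE : d = expR (ln d / ln 2 * ln 2) by rewrite divfK ?gt_eqF// lnK.
rewrite /dyad /powR pnatr_eq0/= [X in (_ <= X)]dE [X in (X < _)]dE.
by rewrite ler_expR ltr_expR ler_pM2r// ltr_pM2r// floor_itv.
Qed.

Lemma zsum_geometric (beta d : R) : (0 < beta) -> (0 < d) ->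
  (zsum (fun k => (dyad k `^ (- beta) * (d < dyad k)%R%:R)%:E) <=
   ((1 - 2 `^ (- beta))^-1 * d `^ (- beta))%:E)%E.
Proof.
move=> b0 d0; set C := (1 - _)^-1.
have C0 : 0 < C by exact: geometric_const_gt0.
have q1 : 0 < 1 - 2 `^ (- beta) by rewrite -invr_gt0.
have dec (x y : R) : (0 < x) -> (x <= y) -> (y `^ (- beta) <= x `^ (- beta)).
  exact/le_powRN/ltW.
(* The telescoping function is [C] times [max(d, 2^k)^(-beta)]: constant below the cutoff, while
   above it the decrement is exactly [2^(-k beta)] because [C (1 - 2^(-beta)) = 1]. *)
apply: (@zsum_telescope _ _ (fun k =>
  C * (if d < dyad k then dyad k `^ (- beta) else d `^ (- beta)))) => k.
  rewrite mulr_ge0 ?powR_ge0//= -mulrBr.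
  have [dk|kd] := ltP d (dyad k); rewrite ?mulr1 ?mulr0.
    rewrite (lt_le_trans dk (dyad_leS k)) dyadS powRM//; last exact/ltW/dyad_gt0.
    rewrite [leRHS](_ : _ = dyad k `^ (- beta))// /C; field.
    by rewrite gt_eqF.
  apply: mulr_ge0; first exact: ltW.
  by rewrite subr_ge0; case: ltP => // dk; apply: dec => //; exact: ltW.
rewrite mulr_ge0 ?(ltW C0)//=; last by case: ifP => _; exact: powR_ge0.
by rewrite ler_pM2l//; case: ltP => // dk; apply: dec => //; exact: ltW.
Qed.

End dyadic_scales.

(** * Measurability of vector-valued maps *)

Section vector_measurability.
Context (R : realType) (n : nat) d (T : measurableType d).
Implicit Types f g : T -> 'rV[R]_n.

Lemma measurable_coord_rV f i : measurable_fun setT f ->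
  measurable_fun setT (fun x => f x ord0 i).
Proof. by move/measurable_fun_rVP. Qed.

Lemma measurable_addrV f g : measurable_fun setT f -> measurable_fun setT g ->
  measurable_fun setT (fun x => f x + g x).
Proof.
move=> mf mg; apply/measurable_fun_rVP => i; under eq_fun do rewrite mxE.
by apply: measurable_funD; exact: measurable_coord_rV.
Qed.

Lemma measurable_scalerV (c : R) f : measurable_fun setT f ->
  measurable_fun setT (fun x => c *: f x).
Proof.
move=> mf; apply/measurable_fun_rVP => i; under eq_fun do rewrite mxE.
by apply: measurable_funM => //; exact: measurable_coord_rV.
Qed.

Lemma measurable_subrV f g : measurable_fun setT f -> measurable_fun setT g ->
  measurable_fun setT (fun x => f x - g x).
Proof.
move=> mf mg; under eq_fun do rewrite -scaleN1r.
by apply: measurable_addrV => //; exact: measurable_scalerV.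
Qed.

Lemma measurable_enorm f : measurable_fun setT f ->
  measurable_fun setT (fun x => enorm (f x)).
Proof.
move=> mf; apply: (measurableT_comp (f := @Num.sqrt R)).
  by apply: continuous_measurable_fun; exact: sqrt_continuous.
apply: measurable_sum => i; apply: measurable_funX.
exact: measurable_coord_rV.
Qed.

Lemma measurable_normrV f : measurable_fun setT f ->
  measurable_fun setT (fun x => `|f x|).
Proof.
move=> mf; apply: (measurableT_comp (f := fun x : 'rV[R]_n => `|x|)) => //.
by apply: continuous_measurable_rV; exact: norm_continuous.
Qed.

Lemma measurable_comp_powR (h : T -> R) (r : R) : measurable_fun setT h ->
  measurable_fun setT (fun x => h x `^ r).
Proof. by move=> mh; apply: (measurableT_comp (measurable_powR r)). Qed.

Lemma measurable_indic_comp d' (U : measurableType d') (A : set U) (f : T -> U) :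
  measurable A -> measurable_fun setT f ->
  measurable_fun setT (fun x => \1_A (f x) : R).
Proof. by move=> mA mf; apply: (measurableT_comp (f := \1_A : U -> R)). Qed.

End vector_measurability.

(** * Double integrals and their changes of variables *)

HB.lock Definition dint (R : realType) (n : nat)
    (f : 'rV[R]_n * 'rV[R]_n -> R) : \bar R :=
  (\int[lebesgue_rV R n \x lebesgue_rV R n]_z (f z)%:E)%E.
Canonical dint_unlockable := Unlockable dint.unlock.

Section double_integral.
Variables (R : realType) (n : nat).
Local Notation V := 'rV[R]_n.
Local Notation mu := (lebesgue_rV R n).
Implicit Types f g : V * V -> R.

Definition nnmeas f := measurable_fun setT f /\ forall z, 0 <= f z.

Lemma dint_ge0 f : (forall z, 0 <= f z) -> (0 <= dint f)%E.
Proof. by move=> f0; rewrite unlock; apply: integral_ge0 => z _;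
    rewrite lee_fin. Qed.

Lemma le_dint f g : nnmeas f -> nnmeas g -> (forall z, f z <= g z) ->
  (dint f <= dint g)%E.
Proof.
move=> [mf f0] [mg g0] fg; rewrite unlock; apply: ge0_le_integral => //.
- by move=> z _; rewrite lee_fin.
- exact/measurable_EFinP.
- exact/measurable_EFinP.
- by move=> z _; rewrite lee_fin.
Qed.

Lemma dintD f g : nnmeas f -> nnmeas g ->
  dint (fun z => f z + g z) = (dint f + dint g)%E.
Proof.
move=> [mf f0] [mg g0]; rewrite unlock -ge0_integralD//;
  by [move=> z _; rewrite lee_fin|exact/measurable_EFinP].
Qed.

Lemma dintZ (c : R) f : 0 <= c -> nnmeas f ->
  dint (fun z => c * f z) = (c%:E * dint f)%E.
Proof.
move=> c0 [mf f0]; rewrite unlock -ge0_integralZl_EFin//; last 1 first.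
  exact/measurable_EFinP.
by move=> z _; rewrite lee_fin.
Qed.

Lemma dint_iter f : nnmeas f ->
  (dint f = \int[mu]_x \int[mu]_y (f (x, y))%:E)%E.
Proof.
move=> [mf f0]; rewrite unlock fubini_tonelli1//; exact/measurable_EFinP.
Qed.

Lemma dint_iterC f : nnmeas f ->
  (dint f = \int[mu]_y \int[mu]_x (f (x, y))%:E)%E.
Proof.
move=> [mf f0]; rewrite unlock fubini_tonelli2//; exact/measurable_EFinP.
Qed.

Lemma nnmeas_comp f (phi : V * V -> V * V) : nnmeas f ->
  measurable_fun setT phi -> nnmeas (f \o phi).
Proof. by move=> [mf f0] mphi; split=> [|z];
    [exact: measurableT_comp|exact: f0]. Qed.

Lemma measurable_shear : measurable_fun setT (fun z : V * V => (z.1, z.1 + z.2)).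
Proof. by apply: measurable_fun_pair => //; apply: measurable_addrV. Qed.

Lemma measurable_shift (c : R) :
  measurable_fun setT (fun z : V * V => (z.1 + c *: z.2, z.2)).
Proof.
apply: measurable_fun_pair => //; apply: measurable_addrV => //.
exact: measurable_scalerV.
Qed.

Lemma measurable_dilation (c : R) :
  measurable_fun setT (fun z : V * V => (z.1, c *: z.2)).
Proof. by apply: measurable_fun_pair => //; exact: measurable_scalerV. Qed.

Lemma nnmeas_pair1 f x : nnmeas f -> measurable_fun setT (fun y => (f (x, y))%:E).
Proof.
move=> [mf _]; apply/measurable_EFinP.
exact: measurable_fun_pair2.
Qed.

Lemma nnmeas_pair2 f y : nnmeas f -> measurable_fun setT (fun x => (f (x, y))%:E).
Proof.
move=> [mf _]; apply/measurable_EFinP.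
exact: measurable_fun_pair1.
Qed.

Lemma dint_swap f : nnmeas f -> dint (fun z => f (z.2, z.1)) = dint f.
Proof.
move=> mf; rewrite dint_iter; last exact: (nnmeas_comp mf (@measurable_swap _ _
    _ _)).
by rewrite dint_iterC.
Qed.

Lemma integral_rV_shift (b : V) (g : V -> \bar R) : measurable_fun setT g ->
  (forall x, 0 <= g x)%E -> (\int[mu]_x g (x + b)%R = \int[mu]_x g x)%E.
Proof.
move=> mg g0; have := ge0_integral_rV_affine b ltr01 mg g0.
by rewrite invr1 expr1n mul1e; under eq_integral do rewrite scale1r.
Qed.

(** Passes from pairs [(x, y)] to a point and a displacement [h = y - x], by translation invariance
    in [y] for fixed [x]. *)
Lemma dint_shear f : nnmeas f -> dint (fun z => f (z.1, z.1 + z.2)) = dint f.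
Proof.
move=> mf; rewrite dint_iter; last exact: (nnmeas_comp mf measurable_shear).
rewrite (dint_iter mf); apply: eq_integral => x _ /=.
rewrite -[RHS](@integral_rV_shift x); last 2 first.
- exact: nnmeas_pair1.
- by move=> y; rewrite lee_fin; case: mf.
by under eq_integral do rewrite addrC.
Qed.

(** With the displacement fixed in the outer integral, the map is a translation of the inner
    variable. *)
Lemma dint_shift (c : R) f : nnmeas f ->
  dint (fun z => f (z.1 + c *: z.2, z.2)) = dint f.
Proof.
move=> mf; rewrite dint_iterC; last exact: (nnmeas_comp mf (measurable_shift c)).
rewrite (dint_iterC mf); apply: eq_integral => y _ /=.
rewrite (@integral_rV_shift _ (fun x => (f (x, y))%:E))//.
- exact: nnmeas_pair2.
- by move=> x; rewrite lee_fin; case: mf.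
Qed.

Lemma dint_dilation (c : R) f : 0 < c -> nnmeas f ->
  dint (fun z => f (z.1, c *: z.2)) = ((c^-1 ^+ n)%:E * dint f)%E.
Proof.
move=> c0 mf.
rewrite dint_iter; last exact: (nnmeas_comp mf (measurable_dilation c)).
have c'0 : 0 <= c^-1 ^+ n by rewrite exprn_ge0// invr_ge0 ltW.
rewrite dint_iter// -ge0_integralZl_EFin//; last 2 first.
- by move=> x _; apply: integral_ge0 => y _; rewrite lee_fin; case: mf.
- have [/measurable_EFinP mf' f0] := mf.
  have f0' z : (0 <= (f z)%:E)%E by rewrite lee_fin.
  exact: (measurable_fun_fubini_tonelli_F (m2 := mu) (EFin \o f) mf' f0').
apply: eq_integral => x _ /=.
rewrite -(@ge0_integral_rV_affine _ _ _ 0 _ c0); last 2 first.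
- exact: nnmeas_pair1.
- by move=> y; rewrite lee_fin; case: mf.
by under [RHS]eq_integral do rewrite addr0.
Qed.

End double_integral.

(** * The kernel *)

Section euclidean_norm.
Variables (R : realType) (n : nat).
Implicit Types x y h : 'rV[R]_n.

Lemma enorm_ge0 x : 0 <= enorm x. Proof. exact: sqrtr_ge0. Qed.

Lemma enorm_sqr x : enorm x ^+ 2 = \sum_(i < n) x ord0 i ^+ 2.
Proof. by rewrite sqr_sqrtr// sumr_ge0// => i _; exact: sqr_ge0. Qed.

Lemma enormZ (c : R) x : enorm (c *: x) = `|c| * enorm x.
Proof.
rewrite /enorm -sqrtr_sqr -sqrtrM ?sqr_ge0//; congr Num.sqrt.
by rewrite mulr_sumr; apply: eq_bigr => i _; rewrite mxE exprMn.
Qed.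

Lemma enormN x : enorm (- x) = enorm x.
Proof. by rewrite -scaleN1r enormZ normrN1 mul1r. Qed.

Lemma enorm0 : enorm (0 : 'rV[R]_n) = 0.
Proof. by rewrite -(scale0r 0) enormZ normr0 mul0r. Qed.

Lemma normrVE x : `|x| = \big[Num.max/0]_ij `|x ij.1 ij.2|.
Proof. by rewrite [LHS]/Num.norm/= mx_normrE. Qed.

Lemma normr_coord_le x i : `|x ord0 i| <= `|x|.
Proof. by rewrite normrVE; apply: (le_bigmax _ (fun ij => `|x ij.1 ij.2|)
    (ord0, i)). Qed.

Lemma normrV_lt x (e : R) : 0 < e -> (`|x| < e) = [forall i, `|x ord0 i| < e].
Proof.
move=> e0; apply/idP/forallP => [xe i|xe];
    first exact: le_lt_trans (normr_coord_le x i) xe.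
rewrite normrVE; apply/bigmax_ltP; split => // -[i j] _ /=.
by rewrite (ord1 i).
Qed.

(** The cut-offs use the sup norm, whose balls are cubes of explicit volume, while the kernel and
    the rearranged sets are Euclidean. This bound and [enorm_le_normr] convert between the two. *)
Lemma normr_le_enorm x : `|x| <= enorm x.
Proof.
rewrite normrVE; apply/bigmax_leP; split => [|[i j] _ /=]; first exact: enorm_ge0.
rewrite (ord1 i) -sqrtr_sqr ler_wsqrtr// (bigD1 j)//= lerDl.
by rewrite sumr_ge0// => k _; exact: sqr_ge0.
Qed.

Lemma enorm_le_normr x : enorm x <= n%:R * `|x|.
Proof.
rewrite -(@ler_pXn2r _ 2)// ?nnegrE ?mulr_ge0 ?enorm_ge0// enorm_sqr.
apply: (@le_trans _ _ (\sum_(i < n) `|x| ^+ 2)).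
  by apply: ler_sum => i _; rewrite -[leLHS]real_normK ?num_real// lerXn2r
      ?nnegrE// normr_coord_le.
rewrite sumr_const card_ord -[leLHS]mulr_natl exprMn ler_wpM2r ?sqr_ge0//.
by rewrite -natrX ler_nat; case: n => // m; rewrite leq_pmulr.
Qed.

Lemma enorm_eq0 x : (enorm x == 0) = (x == 0).
Proof.
apply/eqP/eqP => [x0|->]; last exact: enorm0.
by apply/eqP; rewrite -normr_le0 -x0 normr_le_enorm.
Qed.

(** Termwise [2 x_i y_i <= (b / a) x_i^2 + (a / b) y_i^2] with [a = enorm x] and [b = enorm y]; the
    right-hand sides sum to [2 a b]. *)
Lemma cauchy_schwarz_rV x y :
  \sum_(i < n) x ord0 i * y ord0 i <= enorm x * enorm y.
Proof.
have [->|x0] := eqVneq x 0.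
  by rewrite big1 ?enorm0 ?mul0r// => i _; rewrite mxE mul0r.
have [->|y0] := eqVneq y 0.
  by rewrite big1 ?enorm0 ?mulr0// => i _; rewrite mxE mulr0.
have a0 : 0 < enorm x by rewrite lt_neqAle eq_sym enorm_eq0 x0 enorm_ge0.
have b0 : 0 < enorm y by rewrite lt_neqAle eq_sym enorm_eq0 y0 enorm_ge0.
have H : \sum_(i < n) 2 * (x ord0 i * y ord0 i) <=
    \sum_(i < n) (enorm y / enorm x * x ord0 i ^+ 2 + enorm x / enorm y * y
        ord0 i ^+ 2).
  apply: ler_sum => i _; rewrite -subr_ge0.
  set a := enorm x in a0 *; set b := enorm y in b0 *.
  rewrite (_ : _ - _ = (b * x ord0 i - a * y ord0 i) ^+ 2 / (a * b)); last first.
    by field; rewrite !gt_eqF.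
  by rewrite divr_ge0 ?sqr_ge0// mulr_ge0// ltW.
move: H; rewrite -mulr_sumr big_split/= -!mulr_sumr -!enorm_sqr.
rewrite (_ : _ + _ = 2 * (enorm x * enorm y)); first by rewrite ler_pM2l.
by field; rewrite !gt_eqF.
Qed.

Lemma ler_enormD x y : enorm (x + y) <= enorm x + enorm y.
Proof.
rewrite -(@ler_pXn2r _ 2)// ?nnegrE ?addr_ge0 ?enorm_ge0// sqrrD !enorm_sqr.
under eq_bigr do rewrite mxE sqrrD.
by rewrite !big_split/= lerD2r lerD2l -mulr2n ler_pMn2r// cauchy_schwarz_rV.
Qed.

Lemma lebesgue_rV_cube (e : R) : 0 < e ->
  lebesgue_rV R n [set x | `|x| < e] = ((2 * e) ^+ n)%:E.
Proof.
move=> e0; rewrite (_ : [set x | _] =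
    [set x : 'rV[R]_n | forall i, `](- e), e[%classic (x ord0 i)]); last first.
  apply/seteqP; split=> x /=; rewrite normrV_lt//.
    by move=> /forallP + i => /(_ i); rewrite in_itv/= ltr_norml.
  by move=> xe; apply/forallP => i; have := xe i; rewrite in_itv/= ltr_norml.
rewrite (lebesgue_rV_box (A := fun=> `](- e), e[%classic))//.
rewrite lebesgue_measure_itv/= lte_fin ifT ?gtrN// -EFinB opprK.
by rewrite prodEFin prodr_const card_ord mulr2n mulrDl mul1r.
Qed.

End euclidean_norm.

(** * Dyadic decomposition and tail integrability of the Riesz kernel *)

Section riesz_kernel.
Variables (R : realType) (n : nat).
Local Notation V := 'rV[R]_n.
Local Notation mu := (lebesgue_rV R n).
Implicit Types (h : V) (a b : R).

Definition kern b h : R := enorm h `^ (- b).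

Lemma kern_ge0 b h : 0 <= kern b h. Proof. exact: powR_ge0. Qed.

Lemma kernN b h : kern b (- h) = kern b h. Proof. by rewrite /kern enormN. Qed.

Lemma kernZ b (c : R) h : 0 <= c -> kern b (c *: h) = c `^ (- b) * kern b h.
Proof. by move=> c0; rewrite /kern enormZ ger0_norm// powRM// enorm_ge0. Qed.

Lemma measurable_kern b d (T : measurableType d) (f : T -> V) :
  measurable_fun setT f -> measurable_fun setT (fun x => kern b (f x)).
Proof. by move=> mf; apply: measurable_comp_powR; exact: measurable_enorm. Qed.

Lemma measurable_lt_normr (e : R) d (T : measurableType d) (f : T -> V) :
  measurable_fun setT f -> measurable_fun setT (fun x => (`|f x| < e)%R%:R : R).
Proof.
move=> mf.
have -> : (fun x => (`|f x| < e)%R%:R) = (fun x => \1_(`]-oo, e[%classic : set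
    R) `|f x|%R) :> (T -> R).
  by apply/funext => x; rewrite indicE mem_setE in_itv.
by apply: measurable_indic_comp => //; exact: measurable_normrV.
Qed.

Lemma measurable_ge_normr (e : R) d (T : measurableType d) (f : T -> V) :
  measurable_fun setT f -> measurable_fun setT (fun x => (e <= `|f x|)%R%:R : R).
Proof.
move=> mf; rewrite (_ : (fun x => _) = fun x => 1 - (`|f x| < e)%R%:R).
  by apply: measurable_funB => //; exact: measurable_lt_normr.
by apply/funext => x; rewrite leNgt; case: ltP; rewrite ?subrr ?subr0.
Qed.

(** One term suffices: if [2^k <= |h| < 2^(k+1)], the term of index [k + 1] is [2^(-b) 2^(-k b)],
    and the Euclidean norm is at least [2^k]. *)
Lemma kern_le_zsum b h : 0 < b ->
  ((kern b h)%:E <= (2 `^ b)%:E *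
    zsum (fun k => (dyad R k `^ (- b) * (`|h| < dyad R k)%R%:R)%:E))%E.
Proof.
move=> b0.
have t0 (x : V) k : (0 <= (dyad R k `^ (- b) * (`|x| < dyad R k)%R%:R)%:E)%E.
  by rewrite lee_fin mulr_ge0 ?powR_ge0.
(* A power of 0 with nonzero exponent is 0, so the kernel vanishes at the origin. *)
have [->|h0] := eqVneq h 0.
  rewrite /kern enorm0 powR0 ?oppr_eq0 ?gt_eqF//; apply: mule_ge0.
    by rewrite lee_fin powR_ge0.
  exact: (zsum_ge0 (t0 0)).
have nh0 : 0 < `|h| by rewrite normr_gt0.
have [k /andP[kh hk]] := ex_dyad nh0.
apply: (@le_trans _ _ ((2 `^ b)%:E * (dyad R (k + 1) `^ (- b))%:E)%E); last first.
  rewrite lee_wpmul2l ?lee_fin ?powR_ge0//.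
  by apply: le_trans (zsum_term (k + 1) (t0 h)); rewrite hk mulr1.
rewrite -EFinM lee_fin dyadS powRM//; last exact/ltW/dyad_gt0.
rewrite mulrA.
rewrite powRN mulfV ?gt_eqF ?powR_gt0// mul1r.
apply: le_powRN; [exact: ltW|exact: dyad_gt0|].
exact: le_trans kh (normr_le_enorm h).
Qed.

(** The sum is geometric over the scales above [|h| / L], hence comparable to [|h|^(-b)]. The origin
    is excluded: there every scale counts and the series diverges, whereas [kern b 0] is 0. *)
Lemma zsum_le_kern b (L : R) : 0 < b -> 0 < L -> exists2 C : R, 0 < C &
  forall h, h != 0 ->
  (zsum (fun k => (dyad R k `^ (- b) * (`|h| < L * dyad R k)%R%:R)%:E)
    <= (C * kern b h)%:E)%E.
Proof.
move=> b0 L0; set q : R := (1 - 2 `^ (- b))^-1.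
have q0 : 0 < q by exact: geometric_const_gt0.
exists (q * (n.+1%:R * L) `^ b) => [|h h0].
  by rewrite mulr_gt0 ?powR_gt0 ?mulr_gt0.
have nh0 : 0 < `|h| by rewrite normr_gt0.
have d0 : 0 < `|h| / L by rewrite divr_gt0.
rewrite (@eq_zsum _ _ (fun k => (dyad R k `^ (- b) * (`|h| / L < dyad R
    k)%R%:R)%:E)).
  apply: (le_trans (zsum_geometric b0 d0)).
  rewrite lee_fin -mulrA ler_pM2l//.
  have e0 : 0 < enorm h by exact: lt_le_trans (normr_le_enorm h).
  apply: (@le_trans _ _ ((enorm h / (n.+1%:R * L)) `^ (- b))).
    apply: le_powRN; [exact: ltW|by rewrite divr_gt0 ?mulr_gt0|].
    rewrite ler_pdivrMr ?mulr_gt0// mulrCA divfK ?gt_eqF//.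
    apply: (le_trans (enorm_le_normr h)).
    by rewrite ler_wpM2r// ler_nat.
  have x0 : 0 < n.+1%:R * L by rewrite mulr_gt0.
  rewrite /kern; set x := n.+1%:R * L in x0 *.
  set t := enorm h / x; have t0 : 0 <= t by rewrite divr_ge0 ?enorm_ge0 ?ltW.
  rewrite (_ : enorm h = t * x); last by rewrite divfK// gt_eqF.
  rewrite powRM ?(ltW x0)// mulrCA [x `^ (- b)]powRN mulfV ?mulr1//.
  by rewrite gt_eqF// powR_gt0.
by move=> k; rewrite ltr_pdivrMr// (mulrC L).
Qed.

Lemma measurable_cube (e : R) : measurable [set h : V | `|h| < e].
Proof.
rewrite (_ : [set h | _] = (fun h : V => `|h|) @^-1` `]-oo, e[%classic).
  apply: measurable_preimage => //; exact: (measurable_normrV (f := id)).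
by apply/seteqP; split => h /=; rewrite in_itv.
Qed.

(** Over the cube [|h| < 2^k] the dyadic term of index [k] integrates to at most [2^n 2^(-k a)].
    Only scales with [2^k > e] meet the region [|h| >= e], so the series converges. *)
Lemma kern_tail_lty a e : 0 < a -> 0 < e ->
  (\int[mu]_h (kern (n%:R + a) h * (e <= `|h|)%R%:R)%:E < +oo)%E.
Proof.
move=> a0 e0; set b := n%:R + a.
have b0 : 0 < b by rewrite ltr_wpDl.
pose T k h := (dyad R k `^ (- b) * (`|h| < dyad R k)%R%:R * (e <= `|h|)%R%:R)%:E.
have mc : measurable_fun setT (fun h : V => (e <= `|h|)%R%:R : R).
  exact: (@measurable_ge_normr _ _ _ id).
have mT k : measurable_fun setT (T k).
  apply/measurable_EFinP; apply: measurable_funM => //.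
  by apply: measurable_funM => //; exact: (@measurable_lt_normr _ _ _ id).
have T0 k h : (0 <= T k h)%E by rewrite lee_fin !mulr_ge0 ?powR_ge0.
have mk : measurable_fun setT (fun h => kern b h) by exact: (@measurable_kern _
    _ _ id).
apply: (@le_lt_trans _ _ (\int[mu]_h ((2 `^ b)%:E * zsum (T ^~ h)))%E).
  apply: ge0_le_integral => //.
  - by move=> h _; rewrite lee_fin mulr_ge0// kern_ge0.
  - by apply/measurable_EFinP; apply: measurable_funM.
  - by apply: measurable_funeM; exact: measurable_zsum.
  - move=> h _; have [eh|] := leP e `|h|; last first.
      move=> _; rewrite mulr0; apply: mule_ge0; first by rewrite lee_fin powR_ge0.
      exact: zsum_ge0.
    rewrite mulr1 (le_trans (kern_le_zsum h b0))// lee_wpmul2l ?lee_fin ?powR_ge0//.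
    apply: le_zsum => k; first by rewrite lee_fin mulr_ge0 ?powR_ge0.
    by rewrite /T eh mulr1.
rewrite ge0_integralZl_EFin ?powR_ge0//; last 2 first.
- by move=> h _; exact: zsum_ge0.
- exact: measurable_zsum.
rewrite integral_zsum//.
apply: lte_mul_pinfty => //.
apply: (@le_lt_trans _ _ (zsum (fun k => (2 ^+ n)%:E *
   (dyad R k `^ (- a) * (e < dyad R k)%R%:R)%:E))%E).
  apply: le_zsum => k; first exact: integral_ge0.
  have [ek|ke] := ltP e (dyad R k); last first.
    rewrite mulr0 mule0 integral0_eq// => h _; rewrite /T.
    have [hk|] := ltP `|h| (dyad R k); last by rewrite mulr0 mul0r.
    by rewrite leNgt (lt_le_trans hk ke) mulr0.
  rewrite mulr1.
  apply: (@le_trans _ _ (\int[mu]_h ((dyad R k `^ (- b))%:E *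
     (\1_[set h : V | `|h| < dyad R k] h)%:E))%E).
    apply: ge0_le_integral => //.
    - by apply: measurable_funeM; apply/measurable_EFinP;
        apply: measurable_indic; exact: measurable_cube.
    - move=> h _; rewrite /T lee_fin indicE -mulrA ler_wpM2l ?powR_ge0//.
      rewrite (_ : (h \in _) = (`|h| < dyad R k)); last by apply/idP/idP;
          rewrite inE.
      by rewrite ler_piMr//; case: (e <= `|h|).
  rewrite ge0_integralZl_EFin ?powR_ge0//; last first.
    by apply/measurable_EFinP; apply: measurable_indic; exact: measurable_cube.
  rewrite integral_indic//; last exact: measurable_cube.
  rewrite setIT [X in (_ * X <= _)%E](_ : _ = ((2 * dyad R k) ^+ n)%:E); last first.
    exact/lebesgue_rV_cube/dyad_gt0.
  rewrite -!EFinM lee_fin.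
  rewrite exprMn mulrCA ler_wpM2l ?exprn_ge0// /b opprD powRD; last first.
    by rewrite [dyad R k == 0]gt_eqF ?dyad_gt0// implybT.
  rewrite mulrAC [_ `^ (- n%:R)]powRN powR_mulrn; last exact/ltW/dyad_gt0.
  by rewrite mulVf ?mul1r// gt_eqF// exprn_gt0// dyad_gt0.
rewrite zsumZl; last by move=> k; rewrite lee_fin mulr_ge0 ?powR_ge0.
apply: (@le_lt_trans _ _ ((2 ^+ n)%:E * ((1 - 2 `^ (- a))^-1 * e `^ (- a))%:E)%E).
  by rewrite lee_wpmul2l ?lee_fin ?exprn_ge0// zsum_geometric.
by rewrite -EFinM ltry.
Qed.

End riesz_kernel.

(** * From the domain to the whole space *)

Section compactly_supported.
Variables (R : realType) (n : nat).
Local Notation V := 'rV[R]_n.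
Implicit Types (K U : set V) (u : V -> R).

Lemma compact_normr_lt K : compact K ->
  exists2 L : R, 0 < L & forall x, K x -> `|x| < L.
Proof.
move=> /compact_bounded [M [_ HM]]; exists (`|M| + 2); first by rewrite ltr_wpDl.
move=> x Kx; apply: (@le_lt_trans _ _ (`|M| + 1)); last by rewrite ltrD2l ltr1n.
by apply: HM => //; rewrite (le_lt_trans (ler_norm M))// ltrDl.
Qed.

Lemma compact_continuous_le K u : compact K -> continuous u ->
  exists2 M : R, 0 < M & forall x, K x -> u x <= M.
Proof.
move=> cK cu.
have /compact_bounded [M [_ HM]] : compact (u @` K : set R^o).
  by apply: continuous_compact => //; exact: continuous_subspaceT.
exists (`|M| + 1); first by rewrite ltr_wpDl.
move=> x Kx; apply: (le_trans (ler_norm _)).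
apply: HM; last by exists x.
by rewrite (le_lt_trans (ler_norm M))// ltrDl.
Qed.

(** If the ball of radius [r] around [x] lies in [U], the margin [r / 2] works for all points at
    distance less than [r / 2] from [x]; compactness makes the margin uniform. *)
Lemma compact_sub_open K U : compact K -> open U -> K `<=` U ->
  exists2 d : R, 0 < d & forall x h, K x -> `|h| < d -> U (x + h).
Proof.
move=> /compact_near_coveringP nK oU KU.
have := nK R (0^'+) (fun d x => forall h, `|h| < d -> U (x + h)) _.
case.
  move=> x Kx; have /nbhs_ballP[r /= r0 rU] : nbhs x U by apply:
      open_nbhs_nbhs; split => //; exact: KU.
  exists (ball x (r / 2), [set e | e < r / 2]) => /=.
    split; first by apply: nbhsx_ballx; rewrite divr_gt0.
    by apply: nbhs_right_lt; rewrite divr_gt0.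
  move=> [y e] /= [xy er] h he; apply: rU.
  rewrite (splitr r); apply: (ball_triangle xy).
  rewrite -ball_normE /= opprD addNKr normrN.
  exact: lt_trans he er.
move=> e /= e0 H; exists (e / 2); first by rewrite divr_gt0.
move=> x h Kx; apply: H => //=; last by rewrite divr_gt0.
by rewrite sub0r normrN gtr0_norm ?divr_gt0// ltr_pdivrMr// ltr_pMr// ltr1n.
Qed.

End compactly_supported.

(** * Hardy-type bound for the energy leaving the domain *)

Section regional_to_global.
Variables (R : realType) (n : nat).
Local Notation V := 'rV[R]_n.
Local Notation mu := (lebesgue_rV R n).

Definition diff_quot (b p : R) (u : V -> R) (z : V * V) : R :=
  `|u z.1 - u z.2| `^ p * kern b (z.1 - z.2).

Lemma nnmeas_diff_quot b p u : measurable_fun setT u -> nnmeas (diff_quot b p u).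
Proof.
move=> mu'; split=> [|z]; last by rewrite mulr_ge0 ?powR_ge0 ?kern_ge0.
apply: measurable_funM; last by apply: measurable_kern; exact: measurable_subrV.
apply: measurable_comp_powR; apply: measurableT_comp => //.
by apply: measurable_funB; exact: measurableT_comp.
Qed.

Lemma nnmeasM (f g : V * V -> R) : nnmeas f -> nnmeas g -> nnmeas (fun z => f z
    * g z).
Proof. by move=> [mf f0] [mg g0]; split=> [|z];
    [exact: measurable_funM|rewrite mulr_ge0]. Qed.

Lemma nnmeasD (f g : V * V -> R) : nnmeas f -> nnmeas g -> nnmeas (fun z => f z
    + g z).
Proof. by move=> [mf f0] [mg g0]; split=> [|z];
    [exact: measurable_funD|rewrite addr_ge0]. Qed.

Lemma nnmeasZ (c : R) (f : V * V -> R) : 0 <= c -> nnmeas f -> nnmeas (fun z =>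
    c * f z).
Proof. by move=> c0 [mf f0]; split=> [|z];
    [exact: measurable_funM|rewrite mulr_ge0]. Qed.

Lemma nnmeas_indic (A : set V) (phi : V * V -> V) : measurable A ->
  measurable_fun setT phi -> nnmeas (fun z => \1_A (phi z)).
Proof. by move=> mA mphi; split=> [|z]; [exact: measurable_indic_comp|]. Qed.

Lemma nnmeas_powR (p : R) (u : V -> R) (phi : V * V -> V) : measurable_fun setT u ->
  measurable_fun setT phi -> nnmeas (fun z => u (phi z) `^ p).
Proof.
move=> mu' mphi; split=> [|z]; last exact: powR_ge0.
by apply: measurable_comp_powR; exact: measurableT_comp.
Qed.

Lemma nnmeas_kern (b : R) (phi : V * V -> V) :
  measurable_fun setT phi -> nnmeas (fun z => kern b (phi z)).
Proof. by move=> mphi; split=> [|z]; [exact: measurable_kern|exact: kern_ge0]. Qed.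

(* Peter-Paul: [C] is chosen so that the second term dominates as soon as
   [b > eta a], where [(1 + eta)^p = 1 + e]. *)
Lemma powRD_le (p e : R) : 0 < p -> 0 < e -> exists2 C : R, 0 < C &
  forall a b, 0 <= a -> 0 <= b -> (a + b) `^ p <= (1 + e) * a `^ p + C * b `^ p.
Proof.
move=> p0 e0; pose eta := (1 + e) `^ p^-1 - 1.
have eta0 : 0 < eta.
  rewrite subr_gt0; have := @gt0_ltr_powR R p^-1 _ 1 (1 + e); rewrite powR1; apply.
  - by rewrite invr_gt0.
  - by rewrite nnegrE.
  - by rewrite nnegrE addr_ge0// ltW.
  - by rewrite ltrDl.
have etap : (1 + eta) `^ p = 1 + e.
  by rewrite /eta addrC subrK -powRrM mulVf ?gt_eqF// powRr1// addr_ge0// ltW.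
clearbody eta; have eta1 : 0 <= 1 + eta by rewrite addr_ge0// ltW.
have C0 : 0 < 1 + eta^-1 by rewrite addr_gt0 ?invr_gt0.
have mono s t : 0 <= s -> s <= t -> s `^ p <= t `^ p.
  move=> s0 st; apply: ge0_ler_powR; rewrite ?nnegrE//; first exact: ltW.
  exact: le_trans st.
exists ((1 + eta^-1) `^ p); first by rewrite powR_gt0.
move=> a b a0 b0; have [bea|eab] := leP b (eta * a).
  rewrite -etap -powRM//.
  rewrite (@le_trans _ _ (((1 + eta) * a) `^ p))//.
    apply: mono; first exact: addr_ge0.
    by rewrite mulrDl mul1r lerD2l.
  by rewrite lerDl mulr_ge0 ?powR_ge0.
rewrite -(powRM p (ltW C0) b0).
rewrite (@le_trans _ _ (((1 + eta^-1) * b) `^ p))//.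
  apply: mono; first exact: addr_ge0.
  by rewrite mulrDl mul1r addrC lerD2l ler_pdivlMl// ltW.
by rewrite lerDr mulr_ge0 ?powR_ge0// addr_ge0// ltW.
Qed.

Lemma dint_prod (f g : V -> R) : measurable_fun setT f -> measurable_fun setT g ->
  (forall x, 0 <= f x) -> (forall x, 0 <= g x) ->
  (dint (fun z => f z.1 * g z.2)%R =
   (\int[mu]_x (f x)%:E) * (\int[mu]_x (g x)%:E))%E.
Proof.
move=> mf mg f0 g0; rewrite dint_iter; last first.
  split=> [|z]; last exact: mulr_ge0.
  by apply: measurable_funM; exact: measurableT_comp.
have mg' : measurable_fun setT (EFin \o g) by exact/measurable_EFinP.
have mf' : measurable_fun setT (EFin \o f) by exact/measurable_EFinP.
under eq_integral => x _.
  under eq_integral do rewrite /= EFinM.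
  rewrite ge0_integralZl_EFin//; last by move=> y _; rewrite lee_fin.
  rewrite muleC.
  over.
rewrite ge0_integralZl//; first by rewrite muleC.
- by move=> x _; rewrite lee_fin.
- by apply: integral_ge0 => x _; rewrite lee_fin.
Qed.

(** Written in coordinates [(x, h)] with [h] a displacement, whereas [diff_quot] and [regional_quot]
    use pairs [(x, y)]. *)
Definition exit_quot (b p : R) (Omega : set V) (u : V -> R) (z : V * V) : R :=
  u z.1 `^ p * \1_(~` Omega) (z.1 + z.2) * kern b z.2.

Definition regional_quot (b p : R) (Omega : set V) (u : V -> R) (z : V * V) : R :=
  \1_Omega z.1 * \1_Omega z.2 * diff_quot b p u z.

(** On integrating the pointwise bound, the dilation produces a factor [2^(-n)] on the left and the
    shift preserves the integral of [G]. After cancelling [2^(-n)], the integrals satisfy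
    [G <= q ((2 + e) G + D E)] with [q = 2^(-al)], and finiteness of the integral of [G] permits
    absorption. *)
Lemma dilation_absorb (al e D : R) (G E : V * V -> R) : 0 < e -> 0 < D ->
  2 `^ (- al) * (2 + e) < 1 -> nnmeas G -> nnmeas E -> (dint G < +oo)%E ->
  (forall z, G (z.1, 2 *: z.2) <=
    2 `^ (- (n%:R + al)) * (G z + ((1 + e) * G (z.1 + 1 *: z.2, z.2) + D * E z))) ->
  (dint G <= (2 `^ (- al) * D / (1 - 2 `^ (- al) * (2 + e)))%:E * dint E)%E.
Proof.
move=> e0 D0 q1 mG mE Gfin key; set q := 2 `^ (- al) in q1 *.
have q0 : 0 < q by rewrite powR_gt0.
have mG2 := nnmeas_comp mG (@measurable_dilation R n 2).
have mG1 := nnmeas_comp mG (@measurable_shift R n 1).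
have e1 : 0 <= 1 + e by rewrite addr_ge0// ltW.
have mS := nnmeasD mG (nnmeasD (nnmeasZ e1 mG1) (nnmeasZ (ltW D0) mE)).
have le2 := le_dint mG2 (nnmeasZ (powR_ge0 _ (- (n%:R + al))) mS) key.
rewrite (dint_dilation (ltr0n _ 2) mG) (dintZ (powR_ge0 _ _) mS) in le2.
rewrite (dintD mG (nnmeasD (nnmeasZ e1 mG1) (nnmeasZ (ltW D0) mE))) in le2.
rewrite (dintD (nnmeasZ e1 mG1) (nnmeasZ (ltW D0) mE)) in le2.
rewrite (dintZ e1 mG1) (dintZ (ltW D0) mE) in le2.
rewrite [dint (_ \o _)](dint_shift 1 mG) in le2.
have G0 : (0 <= dint G)%E by apply: dint_ge0; case: mG.
have E0 : (0 <= dint E)%E by apply: dint_ge0; case: mE.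
have qE : 2 `^ (- (n%:R + al)) = (2^-1) ^+ n * q.
  rewrite opprD powRD ?pnatr_eq0 ?implybT// [2 `^ (- n%:R)]powRN powR_mulrn//.
  by rewrite exprVn.
rewrite qE in le2; move: le2 Gfin G0 E0.
have c0 : 0 < q * D / (1 - q * (2 + e)) by rewrite divr_gt0 ?mulr_gt0// subr_gt0.
case: (dint E) => [x| |] //; case: (dint G) => [g| |] //; last first.
  by move=> _ _ _ _; rewrite gt0_muley ?leey// lte_fin.
rewrite -?(EFinM, EFinD) !lee_fin -[_ * q * _]mulrA ler_pM2l ?exprn_gt0// => H
    _ g0 x0.
rewrite mulrAC ler_pdivlMr ?subr_gt0//; lra.
Qed.

(* If [x + 2h] lies outside [Omega], then either [x + h] does too, or [u x]
   is compared with [u (x + h)], where [x + h] is one step [h] away from the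
   complement.  After the dilation [h -> 2h] both cases reproduce the left-hand
   side, with total factor close to [2^(1 - al) < 1], so they are absorbed. *)
Lemma hardy_complement (al p : R) : 1 < al -> 0 < p -> exists2 C : R, 0 < C &
  forall (Omega : set V) (u : V -> R), open Omega -> continuous u ->
  (forall x, 0 <= u x) -> compact (closure [set x | u x != 0]) ->
  closure [set x | u x != 0] `<=` Omega ->
  (dint (exit_quot (n%:R + al) p Omega u)
   <= C%:E * dint (regional_quot (n%:R + al) p Omega u))%E.
Proof.
move=> al1 p0; set b := n%:R + al.
have al0 : 0 < al by exact: lt_trans al1.
have b0 : 0 < b by rewrite ltr_wpDl.
have pow2 : 2 < 2 `^ al :> R.
  rewrite -[al](subrK 1) powRD ?pnatr_eq0 ?implybT// powRr1// ltr_pMl//.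
  have := @gt0_ltr_powR R (al - 1) _ 1 2; rewrite powR1; apply;
    by rewrite ?nnegrE ?subr_gt0 ?ltr1n.
(* Half of the gap [2^al - 2], so that [2 + e] stays below [2^al]. *)
pose e : R := (2 `^ al - 2) / 2.
have e0 : 0 < e by rewrite divr_gt0// subr_gt0.
have [D D0 HD] := powRD_le p0 e0.
pose q : R := 2 `^ (- al).
have q0 : 0 < q by rewrite powR_gt0.
have q1 : q * (2 + e) < 1.
  rewrite /q powRN ltr_pdivrMl ?powR_gt0// mulr1 /e; lra.
exists (q * D / (1 - q * (2 + e))).
  by rewrite divr_gt0 ?mulr_gt0// subr_gt0.
move=> Omega u oO cu u0 cK KO; set K := closure _ in cK KO.
have mu' : measurable_fun setT u by exact: continuous_measurable_rV.
have mO : measurable Omega by exact: open_measurable_rV.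
have mOc : measurable (~` Omega) by exact: measurableC.
have uK x : ~ K x -> u x = 0.
  by move=> Kx; apply/eqP; apply: contrapT => /negP ux; apply: Kx;
      exact: subset_closure.
have uO x : ~ Omega x -> u x = 0 by move=> Ox; apply: uK => /KO.
have m1 : measurable_fun setT (fun z : V * V => z.1) by exact: measurable_fst.
have m2 : measurable_fun setT (fun z : V * V => z.2) by exact: measurable_snd.
have m12 : measurable_fun setT (fun z : V * V => z.1 + z.2) by exact:
    measurable_addrV.
have mG : nnmeas (exit_quot b p Omega u).
  apply: nnmeasM; last exact: nnmeas_kern.
  by apply: nnmeasM; [exact: nnmeas_powR|exact: nnmeas_indic].
have mQ : nnmeas (regional_quot b p Omega u).
  apply: nnmeasM; last exact: nnmeas_diff_quot.
  by apply: nnmeasM; exact: nnmeas_indic.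
rewrite -[dint (regional_quot _ _ _ _)](dint_shear mQ).
have mE := nnmeas_comp mQ (@measurable_shear R n).
apply: (dilation_absorb e0 D0 q1 mG mE).
(* Finiteness, for the absorption: [u <= M] on the support, which lies in the cube [|x| < L], and a
   displacement leaving [Omega] from the support has norm at least [d]. The integrand is thus
   dominated by a product of a bounded function of [x] supported in a cube and a kernel tail in
   [h]. *)
- have [L L0 HL] := compact_normr_lt cK.
  have [M M0 HM] := compact_continuous_le cK cu.
  have [d d0 Hd] := compact_sub_open cK oO KO.
  pose f (x : V) : R := M `^ p * \1_[set x : V | `|x| < L] x.
  pose g (h : V) : R := kern b h * (d <= `|h|)%R%:R.
  have mf : measurable_fun setT f.
    by apply: measurable_funM => //; apply: measurable_indic; exact: measurable_cube.
  have mg : measurable_fun setT g.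
    apply: measurable_funM; first exact: (@measurable_kern _ _ _ _ _ id).
    exact: (@measurable_ge_normr _ _ _ _ _ id).
  have f0 x : 0 <= f x by rewrite mulr_ge0 ?powR_ge0.
  have g0 x : 0 <= g x by rewrite mulr_ge0 ?kern_ge0.
  have mfg : nnmeas (fun z : V * V => f z.1 * g z.2).
    by split=> [|z]; [apply: measurable_funM;
        exact: measurableT_comp|exact: mulr_ge0].
  apply: (@le_lt_trans _ _ (dint (fun z : V * V => f z.1 * g z.2)%R)).
    apply: le_dint => // -[x h]; rewrite /exit_quot /f /g /=.
    have [Kx|Kx] := pselect (K x); last first.
      by rewrite uK// powR0 ?gt_eqF// !mul0r; apply: mulr_ge0; [exact: f0|exact: g0].
    have [Oxh|Oxh] := pselect (Omega (x + h)).
      rewrite [\1_(~` _) _]indicE memNset; last exact.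
      by rewrite mulr0 mul0r; apply: mulr_ge0; [exact: f0|exact: g0].
    have dh : d <= `|h| by rewrite leNgt; apply/negP => hd; apply: Oxh; exact: Hd.
    rewrite dh mulr1 ler_wpM2r ?kern_ge0// !indicE !mem_set ?mulr1//=;
        last exact: HL.
    by apply: ge0_ler_powR; rewrite ?nnegrE// ?(ltW M0) ?(ltW p0)//; exact: HM.
  rewrite dint_prod// lte_mul_pinfty//.
  - by apply: integral_ge0 => x _; rewrite lee_fin.
  - rewrite /f; under eq_integral do rewrite EFinM.
    rewrite ge0_integralZl_EFin ?powR_ge0//; last first.
      by apply/measurable_EFinP; apply: measurable_indic; exact: measurable_cube.
    rewrite integral_indic//; last exact: measurable_cube.
    rewrite setIT [X in (_ * X)%E](_ : _ = ((2 * L) ^+ n)%:E)//.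
    exact: lebesgue_rV_cube.
  - exact: kern_tail_lty.
move=> [x h]; rewrite /exit_quot /regional_quot /diff_quot /= scale1r.
rewrite (_ : x - (x + h) = - h); last by rewrite opprD addrA subrr sub0r.
rewrite kernN kernZ// (_ : x + 2 *: h = x + h + h); last first.
  by rewrite scaler_nat mulr2n addrA.
rewrite mulrCA ler_wpM2l ?powR_ge0//.
set kh := kern b h; have kh0 : 0 <= kh by exact: kern_ge0.
set U := u x `^ p; set U1 := u (x + h) `^ p; set W := `|_| `^ p.
have [U_0 U1_0 W_0] : [/\ 0 <= U, 0 <= U1 & 0 <= W] by rewrite !powR_ge0.
rewrite [leRHS](_ : _ = (U * \1_(~` Omega) (x + h) + ((1 + e) *
   (U1 * \1_(~` Omega) (x + h + h)) + D * (\1_Omega x * \1_Omega (x + h) * W)))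
       * kh); last by ring.
rewrite ler_wpM2r//.
have e1 : 0 <= 1 + e by rewrite addr_ge0// ltW.
have R0 : 0 <= U * \1_(~` Omega) (x + h) + ((1 + e) *
   (U1 * \1_(~` Omega) (x + h + h)) + D * (\1_Omega x * \1_Omega (x + h) * W)).
  apply: addr_ge0; first exact: mulr_ge0.
  by apply: addr_ge0; apply: mulr_ge0 => //;
      [exact: mulr_ge0|exact: ltW|rewrite !mulr_ge0].
(* The left-hand side is 0 when [x + 2h] is in [Omega] or [x] is not. Otherwise the first term on
   the right suffices if [x + h] is outside [Omega]; if it is inside, the choice of [D] applies to
   [u x <= u (x + h) + |u x - u (x + h)|]. *)
have [Oxhh|Oxhh] := pselect (Omega (x + h + h)).
  by rewrite [in leLHS]indicE memNset ?mulr0//; exact.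
have [Ox|Ox] := pselect (Omega x); last first.
  by rewrite {1}/U uO// powR0 ?gt_eqF// mul0r.
have [Oxh|Oxh] := pselect (Omega (x + h)); last first.
  rewrite ![\1_(~` Omega) _]indicE !mem_set// !mulr1 lerDl.
  by apply: addr_ge0; apply: mulr_ge0 => //; [exact: ltW|rewrite !mulr_ge0].
rewrite !indicE (memNset (_ : ~ (~` Omega) (x + h))); last exact.
rewrite !mem_set// !mulr1 mul1r mulr0 add0r.
apply: (@le_trans _ _ ((u (x + h) + `|u x - u (x + h)|) `^ p)); last exact: HD.
apply: ge0_ler_powR; rewrite ?nnegrE ?addr_ge0//; first exact: ltW.
by rewrite addrC -lerBlDr ler_norm.
Qed.

(** Split the pairs by membership in [Omega]. On each mixed block [u] vanishes at the outer point,
    leaving [u^p] times the kernel; by symmetry both blocks give the integral bounded in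
    [hardy_complement]. Pairs with both points outside contribute 0. *)
Lemma regional_hardy (al p : R) : 1 < al -> 0 < p -> exists2 C : R, 0 < C &
  forall (Omega : set V) (u : V -> R), open Omega -> continuous u ->
  (forall x, 0 <= u x) -> compact (closure [set x | u x != 0]) ->
  closure [set x | u x != 0] `<=` Omega ->
  (dint (diff_quot (n%:R + al) p u)
   <= C%:E * dint (regional_quot (n%:R + al) p Omega u))%E.
Proof.
move=> al1 p0; have [C C0 HC] := hardy_complement al1 p0.
exists (1 + 2 * C); first by rewrite addr_gt0// mulr_gt0.
move=> Omega u oO cu u0 cK KO; set b := n%:R + al.
have {HC} := HC Omega u oO cu u0 cK KO; rewrite -/b => HC.
have mu' : measurable_fun setT u by exact: continuous_measurable_rV.
have mO : measurable Omega by exact: open_measurable_rV.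
have mOc : measurable (~` Omega) by exact: measurableC.
have uO x : ~ Omega x -> u x = 0.
  move=> Ox; apply/eqP; apply: contrapT => /negP ux; apply: Ox; apply: KO.
  exact: subset_closure.
have m1 : measurable_fun setT (fun z : V * V => z.1) by exact: measurable_fst.
have m2 : measurable_fun setT (fun z : V * V => z.2) by exact: measurable_snd.
have mQ : nnmeas (regional_quot b p Omega u).
  apply: nnmeasM; last exact: nnmeas_diff_quot.
  by apply: nnmeasM; exact: nnmeas_indic.
pose X (z : V * V) : R := u z.1 `^ p * \1_(~` Omega) z.2 * kern b (z.1 - z.2).
have mX : nnmeas X.
  apply: nnmeasM; last by apply: nnmeas_kern; exact: measurable_subrV.
  by apply: nnmeasM; [exact: nnmeas_powR|exact: nnmeas_indic].
have mXs : nnmeas (fun z => X (z.2, z.1)) := nnmeas_comp mX (@measurable_swap _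
    _ _ _).
have mXX := nnmeasD mX mXs.
have XG : dint X = dint (exit_quot b p Omega u).
  apply: etrans (esym (dint_shear mX)) _; congr (dint _); apply/funext => z.
  by rewrite /X /exit_quot /= (_ : z.1 - (z.1 + z.2) = - z.2) ?kernN// opprD
      addrA subrr sub0r.
have H : (dint (diff_quot b p u) <=
    dint (fun z => regional_quot b p Omega u z + (X z + X (z.2, z.1)))%R)%E.
  apply: le_dint; [exact: nnmeas_diff_quot|exact: nnmeasD|].
  clear HC XG; move=> [x y]; clear mX mXs mXX mQ;
      rewrite /regional_quot /diff_quot /X /= -(kernN b (y - x)) opprB.
  have : 0 <= kern b (x - y) by exact: kern_ge0.
  move: (kern b (x - y)) => k k0; rewrite -mulrDl mulrA -mulrDl ler_wpM2r// !indicE.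
  have [Ox|Ox] := pselect (Omega x); have [Oy|Oy] := pselect (Omega y).
  - by rewrite !(mem_set Ox) !(mem_set Oy) !mul1r lerDl addr_ge0 ?mulr_ge0 ?powR_ge0.
  - rewrite !(memNset Oy) mulr0 mul0r add0r (mem_set (_ : (~` Omega) y))//
      mulr1 (uO y)// subr0.
    by rewrite ger0_norm// lerDl mulr_ge0 ?powR_ge0.
  - rewrite !(memNset Ox) !mul0r add0r (mem_set (_ : (~` Omega) x))// mulr1 (uO
      x)// sub0r normrN.
    by rewrite ger0_norm// lerDr mulr_ge0 ?powR_ge0.
  - by rewrite (uO x)// (uO y)// subrr normr0 powR0 ?gt_eqF// !mul0r mulr0 !addr0.
move: (exit_quot _ _ _ _) (regional_quot _ _ _ _) mQ HC XG H => G Q mQ HC XG H.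
clearbody X; apply: (le_trans H).
rewrite (dintD mQ mXX) (dintD mX mXs) (dint_swap mX) XG.
rewrite EFinD ge0_muleDl// ?lee_fin ?mulr_ge0 ?(ltW C0)// mul1e leeD2l//.
rewrite mulr_natl mulr2n EFinD ge0_muleDl ?lee_fin ?(ltW C0)//.
exact: leeD.
Qed.
End regional_to_global.

(** * Comparison of a pair of sets with balls *)

Section exit_pairs.
Variables (R : realType) (n : nat).
Local Notation V := 'rV[R]_n.
Local Notation mu := (lebesgue_rV R n).
Implicit Types (A E : set V) (rho : R).

(** The integrand of [G(rho; A, E)] in point and displacement coordinates, with distances in the sup
    norm. *)
Definition exits A E rho (z : V * V) : R :=
  \1_A z.1 * \1_(~` E) (z.1 + z.2) * (`|z.2| < rho)%R%:R.

Lemma nnmeas_exits A E rho : measurable A -> measurable E -> nnmeas (exits A E rho).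
Proof.
move=> mA mE.
have m1 : measurable_fun setT (fun z : V * V => z.1) by exact: measurable_fst.
have m2 : measurable_fun setT (fun z : V * V => z.2) by exact: measurable_snd.
apply: nnmeasM; last by split=> [|z]; [exact: measurable_lt_normr|].
apply: nnmeasM; first exact: nnmeas_indic.
apply: nnmeas_indic; first exact: measurableC.
exact: measurable_addrV.
Qed.

Lemma measurable_indic_rV A : measurable A -> measurable_fun setT (\1_A : V -> R).
Proof. by move=> mA; exact: measurable_indic. Qed.

Lemma measurable_cube_indic rho : measurable_fun setT (fun h : V => (`|h| <
    rho)%R%:R : R).
Proof. exact: (@measurable_lt_normr _ _ _ _ _ id). Qed.

Lemma integral_cube rho : 0 < rho ->
  (\int[mu]_h ((`|h| < rho)%R%:R)%:E = ((2 * rho) ^+ n)%:E)%E.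
Proof.
move=> rho0; rewrite -(lebesgue_rV_cube n rho0).
rewrite (eq_integral (fun h => (\1_[set h : V | `|h| < rho] h)%:E)); last first.
  move=> h _; congr (_ %:R%:E); apply/esym.
  by rewrite (_ : (h \in _) = (`|h| < rho))//; apply/idP/idP; rewrite inE.
by rewrite integral_indic ?setIT//; exact: measurable_cube.
Qed.

Lemma dint_indic_cube A rho : measurable A -> 0 < rho ->
  dint (fun z : V * V => \1_A z.1 * (`|z.2| < rho)%R%:R) = (mu A * ((2 * rho)
      ^+ n)%:E)%E.
Proof.
move=> mA rho0.
rewrite (dint_prod (measurable_indic_rV mA) (measurable_cube_indic rho))//.
by rewrite integral_cube// integral_indic// setIT.
Qed.

Lemma dint_indic_indic A E : measurable A -> measurable E ->
  dint (fun z : V * V => \1_A z.1 * \1_E (z.1 + z.2)) = (mu A * mu E)%E.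
Proof.
move=> mA mE.
have m : nnmeas (fun z : V * V => \1_A z.1 * \1_E z.2 : R).
  by apply: nnmeasM; apply: nnmeas_indic.
rewrite (dint_shear m).
rewrite (dint_prod (measurable_indic_rV mA) (measurable_indic_rV mE))//.
by rewrite !integral_indic// !setIT.
Qed.

Lemma nnmeas_indic_cube A rho : measurable A ->
  nnmeas (fun z : V * V => \1_A z.1 * (`|z.2| < rho)%R%:R).
Proof.
move=> mA; apply: nnmeasM; first exact: nnmeas_indic.
by split=> [|z]; [exact: measurable_lt_normr|].
Qed.

Lemma nnmeas_indic_shear A E : measurable A -> measurable E ->
  nnmeas (fun z : V * V => \1_A z.1 * \1_E (z.1 + z.2) : R).
Proof.
move=> mA mE; apply: nnmeasM; first exact: nnmeas_indic.
by apply: nnmeas_indic => //; exact: measurable_addrV.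
Qed.

Lemma dint_exits_le A E rho : measurable A -> measurable E -> 0 < rho ->
  (dint (exits A E rho) <= mu A * ((2 * rho) ^+ n)%:E)%E.
Proof.
move=> mA mE rho0; rewrite -dint_indic_cube//; apply: le_dint.
- exact: nnmeas_exits.
- exact: nnmeas_indic_cube.
- by move=> z; rewrite /exits mulrAC ler_piMr// ?mulr_ge0// indicE lern1;
    case: (_ \in _).
Qed.

(** A displacement that does not leave [E] lands in [E], and the pairs from [A] to [E] have total
    measure [|A| |E|]. *)
Lemma dint_exits_ge A E rho : measurable A -> measurable E -> 0 < rho ->
  (mu A * ((2 * rho) ^+ n)%:E <= dint (exits A E rho) + mu A * mu E)%E.
Proof.
move=> mA mE rho0; rewrite -dint_indic_cube// -dint_indic_indic//.
rewrite -dintD; [|exact: nnmeas_exits|exact: nnmeas_indic_shear].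
apply: le_dint; first exact: nnmeas_indic_cube.
  by apply: nnmeasD; [exact: nnmeas_exits|exact: nnmeas_indic_shear].
move=> z; rewrite /exits -[_ * _ * _%:R]mulrA -mulrDr ler_wpM2l// !indicE.
by rewrite in_setC; case: (_ \in _) => /=;
    rewrite ?mul0r ?add0r ?mul1r ?addr0// lern1; case: (_ < _).
Qed.

(** Leaving [A] without leaving [E] means landing in the difference of [E] and [A]; such pairs are
    counted from their landing point, through [dint_shift]. *)
Lemma dint_exits_self A E rho : measurable A -> measurable E -> 0 < rho ->
  (dint (exits A A rho) <=
   dint (exits A E rho) + mu (E `\` A) * ((2 * rho) ^+ n)%:E)%E.
Proof.
move=> mA mE rho0; have mEA : measurable (E `\` A) by exact: measurableD.
pose f (z : V * V) : R := \1_(E `\` A) z.1 * (`|z.2| < rho)%R%:R.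
have mf : nnmeas f by exact: nnmeas_indic_cube.
rewrite -dint_indic_cube// -/f -(dint_shift 1 mf).
have mf1 := nnmeas_comp mf (@measurable_shift R n 1).
rewrite -dintD//; last exact: nnmeas_exits.
apply: le_dint; [exact: nnmeas_exits| |].
  by apply: nnmeasD => //; exact: nnmeas_exits.
move=> z; rewrite /exits /f /= scale1r -mulrDl ler_wpM2r// !indicE !in_setC in_setD.
by case: (_ \in A); case: (_ \in A); case: (_ \in E);
    rewrite /= ?mul0r ?mul1r ?add0r ?addr0.
Qed.

(* A jump by [N h] out of [A] exits [A] at one of its [N] steps. *)
Lemma dint_exits_mul A rho N : measurable A -> 0 < rho -> (0 < N)%N ->
  (dint (exits A A (N%:R * rho)) <= (N%:R ^+ n.+1)%:E * dint (exits A A rho))%E.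
Proof.
move=> mA rho0 N0; have NR0 : 0 < N%:R :> R by rewrite ltr0n.
set f := exits A A (N%:R * rho).
have mf : nnmeas f by exact: nnmeas_exits.
have mg : nnmeas (exits A A rho) by exact: nnmeas_exits.
have := dint_dilation NR0 mf => H.
(* Of the factor [N^(n+1)], the dilation by [N] accounts for [N^n] and the number of steps for
   [N]. *)
rewrite exprSr EFinM -muleA.
suff : (dint (fun z => f (z.1, N%:R *: z.2)%R) <= N%:R%:E * dint (exits A A rho))%E.
  rewrite H => H1; rewrite -[leLHS]mul1e -[1%E](_ : (N%:R ^+ n * N%:R^-1 ^+
      n)%:E = 1%E).
    by rewrite EFinM -muleA lee_wpmul2l// lee_fin exprn_ge0// ltW.
  by rewrite -exprMn mulfV ?gt_eqF// expr1n.
pose g k (z : V * V) := exits A A rho (z.1 + k%:R *: z.2, z.2).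
have mgk k : nnmeas (g k) by exact: (nnmeas_comp mg (@measurable_shift R n k%:R)).
have gk k : dint (g k) = dint (exits A A rho) by exact: dint_shift.
have mS M : nnmeas (fun z => \sum_(k < M) g k z).
  split=> [|z]; last by apply: sumr_ge0 => k _; case: (mgk k).
  by apply: measurable_sum => k; case: (mgk k).
have dS M : dint (fun z => \sum_(k < M) g k z) = (M%:R%:E * dint (exits A A rho))%E.
  elim: M => [|M IH].
    rewrite mul0e (_ : (fun z => _) = (fun z => 0 * exits A A rho z)); last first.
      by apply/funext => z; rewrite big_ord0 mul0r.
    by rewrite dintZ// mul0e.
  rewrite (_ : (fun z => _) = (fun z => \sum_(k < M) g k z + g M z)); last first.
    by apply/funext => z; rewrite big_ord_recr.
  rewrite dintD// IH gk -[in RHS]natr1 EFinD ge0_muleDl ?lee_fin//.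
  by rewrite mul1e.
rewrite -dS; apply: le_dint => //.
  exact: (nnmeas_comp mf (@measurable_dilation R n N%:R)).
move=> [x h]; rewrite /f /exits /=.
rewrite normrZ ger0_norm ?ler0n// ltr_pM2l//.
rewrite /g /exits /= -mulr_suml ler_wpM2r//.
have : x \in A -> forall M : nat, x + M%:R *: h \notin A ->
    1 <= \sum_(k < M) (\1_A (x + k%:R *: h) * \1_(~` A) (x + k%:R *: h + h)) :> R.
  move=> xA; elim=> [|M IH]; first by rewrite scale0r addr0 xA.
  rewrite -natr1 scalerDl scale1r addrA => xM; rewrite big_ord_recr /=.
  have [xMA|/IH S1] := boolP (x + M%:R *: h \in A).
    rewrite [X in _ + X](_ : _ = 1); last by rewrite !indicE in_setC xMA xM mulr1.
    by rewrite lerDr sumr_ge0// => k _; rewrite mulr_ge0.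
  by rewrite (le_trans S1)// lerDl mulr_ge0.
move=> steps; have S0 : 0 <= \sum_(k < N) (\1_A (x + k%:R *: h) * \1_(~` A) (x
    + k%:R *: h + h)) :> R.
  by apply: sumr_ge0 => k _; rewrite mulr_ge0.
have [xA|xA] := boolP (x \in A); last by rewrite [\1_A x]indicE (negbTE xA) mul0r.
have [xN|xN] := boolP (x + N%:R *: h \in A).
  by rewrite [\1_(~` A) (x + _)]indicE in_setC xN mulr0.
apply: le_trans (steps xA N xN).
by rewrite [\1_A x]indicE [\1_(~` A) (x + _)]indicE in_setC xA xN mulr1.
Qed.

(* Averaging over cubes of side comparable to [|A|^(1/n)] sees at least half
   of [A] exit, and [dint_exits_mul] transports this down to all smaller scales. *)
Lemma dint_exits_lower A E (a e rho : R) N : measurable A -> measurable E ->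
  A `<=` E -> mu A = a%:E -> mu E = e%:E -> 0 < rho -> (0 < N)%N ->
  2 * a <= (2 * (N%:R * rho)) ^+ n ->
  (((2 * rho) ^+ n * (a / (2 * N%:R) - (e - a)))%:E <= dint (exits A E rho))%E.
Proof.
move=> mA mE AE Aa Ee rho0 N0 aN; have NR0 : 0 < N%:R :> R by rewrite ltr0n.
have a0 : 0 <= a by rewrite -lee_fin -Aa measure_ge0.
have EA : mu (E `\` A) = (e - a)%:E.
  have Eoo : (mu E < +oo)%E by rewrite Ee ltry.
  have := measureD mE mA Eoo; rewrite (setIidr AE) => ->.
  by move: Aa Ee; rewrite /= => -> ->.
have := dint_exits_self mA mE rho0; rewrite EA.
have := dint_exits_mul mA rho0 N0.
have := dint_exits_ge mA mA (mulr_gt0 NR0 rho0); rewrite Aa.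
have p0 A' E' rho' : (0 <= dint (exits A' E' rho'))%E.
  by apply: dint_ge0 => z; rewrite !mulr_ge0.
have {p0} := (p0 A A (N%:R * rho), p0 A A rho, p0 A E rho).
move: (dint (exits A A (N%:R * rho))) (dint (exits A A rho)) (dint (exits A E rho)).
move=> X Y G [[X0 Y0] G0] H3 H2 H1.
case: G G0 H1 => [g| |]// g0 H1; last by rewrite leey.
case: Y Y0 H1 H2 => [y| |]// y0 H1 H2.
case: X X0 H2 H3 => [x| |]// x0 H2 H3.
move: H1 H2 H3; rewrite -?(EFinM, EFinD) !lee_fin.
rewrite [2 * (N%:R * rho)]mulrCA [(N%:R * _) ^+ n]exprMn in aN *.
set t := (2 * rho) ^+ n; have t0 : 0 < t by rewrite exprn_gt0// mulr_gt0.
rewrite exprSr; set c := N%:R ^+ n in aN *; have c0 : 0 < c by rewrite exprn_gt0.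
move=> H1 H2 H3.
(* [H3] and [aN] give [x >= a c t / 2], since [a^2 <= a c t / 2]. Dividing by [c N] bounds [y] from
   below, and [H1] then subtracts the loss [(e - a) t]. *)
have {H2} Hx : x <= c * (N%:R * y) by rewrite mulrA.
have aa : a * (2 * a) <= a * (c * t) by rewrite ler_wpM2l.
have Hy : c * (a * t / 2) <= c * (N%:R * y) by lra.
rewrite ler_pM2l// in Hy.
have {}Hy : a * t / 2 / N%:R <= y by rewrite ler_pdivrMr// (mulrC y).
rewrite mulrBr (_ : t * (a / (2 * N%:R)) = a * t / 2 / N%:R); first by lra.
by field; rewrite gt_eqF.
Qed.
End exit_pairs.

(** * Exits from balls against exits from arbitrary sets *)

Section euclidean_balls.
Variables (R : realType) (n : nat).
Local Notation V := 'rV[R]_n.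
Local Notation mu := (lebesgue_rV R n).
Implicit Types (A E : set V) (r rho : R).

Definition eball r : set V := [set x | enorm x < r].

Lemma measurable_eball r : measurable (eball r).
Proof.
rewrite (_ : eball r = (@enorm R n) @^-1` `]-oo, r[%classic).
  by apply: measurable_preimage => //; exact: (@measurable_enorm _ _ _ _ id).
by apply/seteqP; split => x /=; rewrite in_itv.
Qed.

(** [v] is the measure of the unit ball, finite because this ball lies in a cube; the power of [r]
    comes from dilation. *)
Lemma lebesgue_rV_eball : exists2 v : R, 0 <= v &
  forall r, 0 < r -> mu (eball r) = (v * r ^+ n)%:E.
Proof.
have m1 := measurable_eball 1.
have fin1 : (mu (eball 1) \is a fin_num).
  rewrite ge0_fin_numE//; apply: (@le_lt_trans _ _ (mu [set x : V | `|x| < 1])).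
    apply: le_measure; rewrite ?inE//; first exact: measurable_cube.
    by move=> x; apply: le_lt_trans; exact: normr_le_enorm.
  by rewrite [X in (X < _)%E](_ : _ = ((2 * 1) ^+ n)%:E) ?ltry//;
      exact: lebesgue_rV_cube.
exists (fine (mu (eball 1))); first by rewrite fine_ge0.
move=> r r0; have r'0 : 0 < r^-1 by rewrite invr_gt0.
have := lebesgue_rV_affine 0 r'0 m1; rewrite invrK EFinM fineK// muleC => <-.
congr (mu _); apply/seteqP; split => x; rewrite /eball /= addr0 enormZ gtr0_norm//;
  by rewrite ltr_pdivrMl// mulr1.
Qed.

(** In the factorization of [a^k - b^k] by [a - b], each of the [k] monomials is at most
    [a^(k-1)]. *)
Lemma subrX_le (a b : R) k : 0 <= b -> b <= a ->
  a ^+ k - b ^+ k <= k%:R * (a - b) * a ^+ k.-1.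
Proof.
move=> b0 ba; have a0 := le_trans b0 ba.
rewrite subrXX -mulrA mulrCA ler_wpM2l ?subr_ge0//.
apply: (@le_trans _ _ (\sum_(i < k) a ^+ k.-1)); last first.
  by rewrite sumr_const card_ord -[leLHS]mulr_natl.
apply: ler_sum => i _; rewrite [leRHS](_ : _ = a ^+ (k.-1 - i) * a ^+ i); last first.
  by rewrite -exprD subnK// -ltnS prednK ?(leq_ltn_trans _ (ltn_ord i)).
rewrite ler_wpM2l ?exprn_ge0//.
by rewrite lerXn2r ?nnegrE.
Qed.

(** A displacement of sup norm below [rho] has Euclidean length at most [n rho], too short to cross
    the gap between the two spheres. *)
Lemma exits_eball_eq0 (r r' rho : R) : n%:R * rho <= r' - r ->
  forall z, exits (eball r) (eball r') rho z = 0.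
Proof.
move=> H [x h]; rewrite /exits /= !indicE in_setC.
have [hr|] := ltP `|h| rho; last by rewrite mulr0.
have [|xr] := boolP (x \in eball r); last by rewrite !mul0r.
rewrite inE /eball /= => xr; rewrite mem_set ?mulr0 ?mul0r//=.
rewrite (le_lt_trans (ler_enormD x h))//.
have := enorm_le_normr h => H1.
have : n%:R * `|h| <= n%:R * rho by rewrite ler_wpM2l// ltW.
lra.
Qed.

(** Only points of the shell [r - n rho <= |x| < r] can exit, and the volume of this shell is at
    most [v n (n rho) r^(n-1)]. *)
Lemma dint_exits_eball_shell (v r r' rho : R) :
  (forall r, 0 < r -> mu (eball r) = (v * r ^+ n)%:E) -> 0 <= v ->
  0 < rho -> n%:R * rho < r -> r <= r' ->
  (dint (exits (eball r) (eball r') rho) <=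
   ((2 * rho) ^+ n * (v * n%:R ^+ 2 * rho * r ^+ n.-1))%:E)%E.
Proof.
move=> Hv v0 rho0 rr rr'; set s := r - n%:R * rho.
have nr0 : 0 <= n%:R * rho by rewrite mulr_ge0// ltW.
have s0 : 0 < s by rewrite subr_gt0.
have r0 : 0 < r by rewrite (le_lt_trans nr0).
have sr : s <= r by rewrite lerBlDr lerDl.
have mr := measurable_eball r; have ms := measurable_eball s.
have mD : measurable (eball r `\` eball s) by exact: measurableD.
apply: (@le_trans _ _ (dint (fun z : V * V =>
    \1_(eball r `\` eball s) z.1 * (`|z.2| < rho)%R%:R)%R)).
  apply: le_dint.
  - by apply: nnmeas_exits; exact: measurable_eball.
  - exact: nnmeas_indic_cube.
  move=> [x h]; rewrite /exits /= !indicE in_setC in_setD.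
  have [hr|] := ltP `|h| rho; last by rewrite !mulr0.
  have [xr|] := boolP (x \in eball r); last by rewrite !mul0r ?andbF ?mul0r.
  have [xs|xs] := boolP (x \in eball s); last by rewrite andbT !mulr1 mul1r
      lern1; case: (_ \in _).
  rewrite [_ \in eball r']mem_set ?mulr0 ?mul0r//=.
  move: xs; rewrite inE /eball/= /s => xs.
  rewrite (le_lt_trans (ler_enormD x h))//.
  have := enorm_le_normr h => H1.
  have : n%:R * `|h| <= n%:R * rho by rewrite ler_wpM2l// ltW.
  lra.
rewrite dint_indic_cube//.
have Eoo : (mu (eball r) < +oo)%E by rewrite Hv ?ltry.
have sub : eball s `<=` eball r by move=> x; rewrite /eball /= => /lt_le_trans;
    apply.
have := measureD mr ms Eoo; rewrite (setIidr sub).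
have := Hv r r0; have := Hv s s0; rewrite /= => -> -> ->.
rewrite -EFinB -EFinM lee_fin mulrC ler_wpM2l//;
    first by rewrite exprn_ge0// mulr_ge0// ltW.
rewrite -mulrBr -!mulrA ler_wpM2l//.
apply: (le_trans (subrX_le _ (ltW s0) sr)).
rewrite (_ : r - s = n%:R * rho); last by rewrite /s; ring.
by rewrite !mulrA.
Qed.

(** The radii are tied to [|A|] and [|E|] through an arbitrary positive [om]. Three regimes: if
    [n rho <= r' - r], no pair exits the balls; if [L rho] is large against [r'], half of the pairs
    exit [E]; in between, the shell bound is matched with [dint_exits_lower], whose loss [|E| - |A|]
    is controlled by [r' - r < n rho]. *)
Lemma dint_exits_eball_le (om : R) : (0 < n)%N -> 0 < om ->
  exists C L : R, [/\ 0 < C, 0 < L & forall A E r r' rho, measurable A ->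
  measurable E -> A `<=` E -> 0 < r -> 0 < r' -> mu A = (om * r ^+ n)%:E ->
  mu E = (om * r' ^+ n)%:E -> 0 < rho ->
  (dint (exits (eball r) (eball r') rho) <= C%:E * dint (exits A E (L * rho)))%E].
Proof.
move=> n0 om0; have [v v0 Hv] := lebesgue_rV_eball.
pose m := n.-1; have nE : n = m.+1 by rewrite prednK.
have nR0 : 0 < n%:R :> R by rewrite ltr0n.
have nR1 : 1 <= n%:R :> R by rewrite ler1n.
(* Chosen so that the cube of half-side [kap t] has at least twice the measure [om t^n]. *)
pose kap : R := 1 + om; have kap1 : 1 <= kap by rewrite lerDl ltW.
have kap0 : 0 < kap by exact: lt_le_trans kap1.
have kapn (t : R) : 0 <= t -> 2 * om * t ^+ n <= (2 * (kap * t)) ^+ n.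
  move=> t0; rewrite mulrA [leRHS]exprMn ler_wpM2r ?exprn_ge0//.
  apply: (@le_trans _ _ (2 * kap)); first by rewrite /kap; lra.
  by rewrite nE ler_eXnr//; rewrite /kap; lra.
pose M : R := n%:R ^+ 2 * 2 ^+ m.
have M0 : 0 <= M by rewrite mulr_ge0 ?exprn_ge0.
(* With [N <= 3 kap r / (L rho)] below, this makes the gain [om r^n / (2 N)] at least
   [om r^(n-1) rho (M + n)]; the part with [M] pays for [|E| - |A|]. *)
pose L : R := 6 * kap * (M + n%:R).
have L0 : 0 < L by rewrite !mulr_gt0// ltr_wpDl.
have L1 : 2 * n%:R * kap <= L.
  rewrite /L; have := mulr_ge0 (ltW kap0) M0.
  by have := mulr_ge0 (ltW kap0) (ltW nR0); clearbody M kap; lra.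
have L1' : 1 <= L by apply: le_trans L1; rewrite -[leLHS]mulr1 ler_pM//; lra.
(* [2 v / om] serves the far regime and [v n^2 / om] the shell regime; adding 1 makes the constant
   positive even if [v] is 0. *)
exists ((2 * v + v * n%:R ^+ 2) / om + 1), L.
have C0 : 0 <= (2 * v + v * n%:R ^+ 2) / om.
  by rewrite divr_ge0 ?(ltW om0)// addr_ge0 ?mulr_ge0 ?exprn_ge0.
split=> [||A E r r' rho mA mE AE r0 r'0 Ar Er rho0]; [by rewrite ltr_wpDl|by []|].
have mono k (x1 x2 : R) : 0 <= x1 -> x1 <= x2 -> x1 ^+ k <= x2 ^+ k.
  by move=> x10 x12; apply: lerXn2r => //; rewrite nnegrE// (le_trans x10).
have rr' : r <= r'.
  have : (mu A <= mu E)%E by rewrite le_measure ?inE.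
  by rewrite Ar Er lee_fin ler_pM2l// ler_pXn2r// nnegrE ltW.
have Lrho0 : 0 < L * rho by rewrite mulr_gt0.
set t := (2 * rho) ^+ n; have t0 : 0 < t by rewrite exprn_gt0// mulr_gt0.
have tL : t <= (2 * (L * rho)) ^+ n.
  apply: mono; first by rewrite mulr_ge0 ?(ltW rho0).
  by rewrite ler_pM2l// ler_peMl// ltW.
have G0 : (0 <= dint (exits A E (L * rho)))%E by apply: dint_ge0 => z;
    rewrite !mulr_ge0.
have [nrho|nrho] := leP (n%:R * rho) (r' - r).
  rewrite (_ : dint _ = 0%E); first by rewrite mule_ge0// lee_fin addr_ge0.
  rewrite (_ : exits _ _ _ = (fun z => 0 * exits A E rho z)); last first.
    by apply/funext => z; rewrite exits_eball_eq0// mul0r.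
  by rewrite dintZ ?mul0e//; exact: nnmeas_exits.
have reduce (g c : R) : 0 <= c -> c <= (2 * v + v * n%:R ^+ 2) / om + 1 ->
    (g%:E <= dint (exits A E (L * rho)))%E ->
    (dint (exits (eball r) (eball r') rho) <= (c * g)%:E)%E ->
    (dint (exits (eball r) (eball r') rho) <=
     ((2 * v + v * n%:R ^+ 2) / om + 1)%:E * dint (exits A E (L * rho)))%E.
  move=> c0 cC gG gl; apply: (le_trans gl); rewrite EFinM.
  apply: (@le_trans _ _ (c%:E * dint (exits A E (L * rho)))%E).
    by rewrite lee_wpmul2l ?lee_fin.
  by rewrite lee_wpmul2r ?lee_fin.
(* Far regime: the cube of half-side [L rho] has at least twice the measure of [E], so at least half
   of the pairs issued from [A] exit [E]. *)
have [far|near] := leP (kap * r') (L * rho).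
  apply: (reduce (om * r ^+ n * t / 2) (2 * v / om)).
  - by rewrite divr_ge0 ?mulr_ge0 ?(ltW om0).
  - rewrite [(2 * v + _) / om]mulrDl -addrA lerDl addr_ge0//.
    by rewrite divr_ge0 ?(ltW om0)// mulr_ge0 ?exprn_ge0.
  - have := dint_exits_ge mA mE Lrho0; rewrite Ar Er.
    case: (dint _) G0 => [g| |]// g0; last by move=> _; rewrite leey.
    rewrite -!EFinM -EFinD !lee_fin.
    have h1 : 2 * (om * r' ^+ n) <= (2 * (L * rho)) ^+ n.
      rewrite mulrA (le_trans (kapn _ (ltW r'0)))//; apply: mono;
          last by rewrite ler_pM2l.
      by rewrite !mulr_ge0 ?(ltW r'0) ?(ltW kap0).
    set s := (2 * (L * rho)) ^+ n in tL h1 *; move=> h2.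
    have or0 : 0 <= om * r ^+ n by rewrite mulr_ge0 ?(ltW om0) ?exprn_ge0 ?(ltW r0).
    have h3 := ler_wpM2l or0 h1; have h4 := ler_wpM2l or0 tL; lra.
  - have mb := measurable_eball.
    apply: (le_trans (dint_exits_le (mb r) (mb r') rho0)).
    rewrite Hv// -EFinM lee_fin -/t le_eqVlt; apply/orP; left; apply/eqP.
    by field; rewrite gt_eqF.
(* From [2 n kap <= L] and [L rho < kap r']. Together with [r' - r < n rho] this forces
   [r' < 2 r]. *)
have n2 : n%:R * rho < r' / 2.
  have : 2 * n%:R * kap * rho < kap * r' by rewrite (le_lt_trans _ near)//
      ler_wpM2r// ltW.
  rewrite mulrAC (mulrC kap) ltr_pM2r//; lra.
have r'r : r' < 2 * r by lra.
pose y : R := kap * r / (L * rho).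
have y0 : 0 < y by rewrite divr_gt0// mulr_gt0.
have /andP[ty yt] := truncn_itv (ltW y0).
pose N := (Num.truncn y).+1.
have yN : y <= N%:R by exact: ltW.
(* Rounding up costs at most a factor 3, because [L rho < kap r' < 2 kap r] gives [y >= 1/2]. *)
have Ny : N%:R <= 3 * y.
  have h2 : 1 <= 2 * y.
    rewrite /y mulrA ler_pdivlMr// mul1r; apply: ltW; apply: (lt_trans near).
    by rewrite mulrCA ltr_pM2l.
  rewrite /N -natr1; lra.
have NR0 : 0 < N%:R :> R by rewrite ltr0n.
apply: (reduce (om * r ^+ m * rho * t) (v * n%:R ^+ 2 / om)).
- by rewrite divr_ge0 ?(ltW om0)// mulr_ge0 ?exprn_ge0.
- rewrite [(2 * v + _) / om]mulrDl [2 * v / om + _]addrC -addrA lerDl addr_ge0//.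
  by rewrite divr_ge0 ?(ltW om0)// mulr_ge0 ?exprn_ge0.
- have aN : 2 * (om * r ^+ n) <= (2 * (N%:R * (L * rho))) ^+ n.
    rewrite mulrA (le_trans (kapn _ (ltW r0)))//; apply: mono.
      by rewrite !mulr_ge0 ?(ltW r0) ?(ltW kap0).
    by rewrite ler_pM2l// -ler_pdivrMr.
  apply: le_trans (dint_exits_lower mA mE AE Ar Er Lrho0 (isT : (0 < N)%N) aN).
  rewrite lee_fin mulrC.
  have h1 : om * r ^+ m * rho * (M + n%:R) <= om * r ^+ n / (2 * N%:R).
    rewrite ler_pdivlMr ?mulr_gt0//.
    apply: (@le_trans _ _ (om * r ^+ m * rho * (M + n%:R) * (2 * (3 * y)))).
      rewrite ler_wpM2l ?ler_pM2l//.
      by rewrite !mulr_ge0 ?addr_ge0 ?(ltW om0) ?(ltW rho0) ?exprn_ge0 ?(ltW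
          r0) ?(ltW nR0).
    rewrite /y /L nE exprS le_eqVlt; apply/orP; left; apply/eqP; field.
    by rewrite !gt_eqF// -?nE ltr_wpDl.
  have h2 : om * r' ^+ n - om * r ^+ n <= om * r ^+ m * rho * M.
    rewrite -mulrBr -!mulrA ler_pM2l//.
    apply: (le_trans (subrX_le n (ltW r0) rr')).
    apply: (@le_trans _ _ (n%:R * (n%:R * rho) * (2 * r) ^+ m)).
      apply: ler_pM; rewrite ?mulr_ge0 ?subr_ge0 ?exprn_ge0 ?(ltW r'0)//.
        by rewrite ler_pM2l// ltW.
      by apply: mono; exact: ltW.
    rewrite /M exprMn le_eqVlt; apply/orP; left; apply/eqP; ring.
  have h3 : om * r ^+ m * rho <= om * r ^+ n / (2 * N%:R) - (om * r' ^+ n - om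
      * r ^+ n).
    have orr : 0 <= om * r ^+ m * rho by rewrite !mulr_ge0 ?(ltW om0)
        ?exprn_ge0 ?(ltW r0) ?(ltW rho0).
    have := ler_wpM2l orr nR1; lra.
  apply: ler_pM => //; first exact: ltW.
  by rewrite !mulr_ge0 ?(ltW om0) ?exprn_ge0 ?(ltW r0) ?(ltW rho0).
- have nr : n%:R * rho < r by lra.
  apply: (le_trans (dint_exits_eball_shell Hv v0 rho0 nr rr')).
  rewrite lee_fin -/t -/m le_eqVlt; apply/orP; left; apply/eqP.
  by field; rewrite gt_eqF.
Qed.

End euclidean_balls.

(** * From single scales to the kernel *)

Section kernel_pairs.
Variables (R : realType) (n : nat).
Local Notation V := 'rV[R]_n.
Local Notation mu := (lebesgue_rV R n).
Implicit Types (A E : set V) (f : V * V -> R).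

Lemma dint_le_zsum f (g : int -> V * V -> R) : nnmeas f ->
  (forall k, nnmeas (g k)) ->
  (forall z, (f z)%:E <= zsum (fun k => (g k z)%:E))%E ->
  (dint f <= zsum (fun k => dint (g k)))%E.
Proof.
move=> [mf f0] mg fg; rewrite unlock.
have mg' k : measurable_fun setT (fun z => (g k z)%:E).
  by apply/measurable_EFinP; case: (mg k).
have g0 k z : (0 <= (g k z)%:E)%E by rewrite lee_fin; case: (mg k).
rewrite -integral_zsum//; apply: ge0_le_integral => //.
- by move=> z _; rewrite lee_fin.
- exact/measurable_EFinP.
- exact: measurable_zsum.
Qed.

Lemma zsum_le_dint f (g : int -> V * V -> R) : nnmeas f ->
  (forall k, nnmeas (g k)) ->
  (forall z, zsum (fun k => (g k z)%:E) <= (f z)%:E)%E ->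
  (zsum (fun k => dint (g k)) <= dint f)%E.
Proof.
move=> [mf f0] mg fg; rewrite unlock.
have mg' k : measurable_fun setT (fun z => (g k z)%:E).
  by apply/measurable_EFinP; case: (mg k).
have g0 k z : (0 <= (g k z)%:E)%E by rewrite lee_fin; case: (mg k).
rewrite -integral_zsum//; apply: ge0_le_integral => //.
- by move=> z _; exact: zsum_ge0.
- exact: measurable_zsum.
- exact/measurable_EFinP.
Qed.

Definition kpairs (b : R) A E (z : V * V) : R :=
  \1_A z.1 * \1_(~` E) z.2 * kern b (z.1 - z.2).

Lemma nnmeas_kpairs b A E : measurable A -> measurable E -> nnmeas (kpairs b A E).
Proof.
move=> mA mE; apply: nnmeasM; last first.
  by apply: nnmeas_kern; exact: measurable_subrV.
by apply: nnmeasM; apply: nnmeas_indic => //; exact: measurableC.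
Qed.

Definition kexits (b : R) A E (z : V * V) : R :=
  \1_A z.1 * \1_(~` E) (z.1 + z.2) * kern b z.2.

Lemma nnmeas_kexits b A E : measurable A -> measurable E -> nnmeas (kexits b A E).
Proof.
move=> mA mE; apply: nnmeasM; last exact: nnmeas_kern.
apply: nnmeasM; first exact: nnmeas_indic.
by apply: nnmeas_indic; [exact: measurableC|exact: measurable_addrV].
Qed.

Lemma dint_kpairs b A E : measurable A -> measurable E ->
  dint (kpairs b A E) = dint (kexits b A E).
Proof.
move=> mA mE; apply: etrans (esym (dint_shear (nnmeas_kpairs b mA mE))) _.
congr (dint _); apply/funext => z.
by rewrite /kpairs /kexits /= (_ : z.1 - (z.1 + z.2) = - z.2) ?kernN// opprD
    addrA subrr sub0r.
Qed.

Lemma dint_kexits_le b A E : 0 < b -> measurable A -> measurable E ->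
  (dint (kexits b A E) <= (2 `^ b)%:E *
    zsum (fun k => (dyad R k `^ (- b))%:E * dint (exits A E (dyad R k))))%E.
Proof.
move=> b0 mA mE.
have me k : nnmeas (exits A E (dyad R k)) by exact: nnmeas_exits.
have mg k : nnmeas (fun z => dyad R k `^ (- b) * exits A E (dyad R k) z).
  by apply: nnmeasZ => //; exact: powR_ge0.
rewrite -zsumZl; last first.
  by move=> k; rewrite -dintZ ?powR_ge0//; apply: dint_ge0; case: (mg k).
rewrite (_ : (fun k => _) = (fun k => dint (fun z => 2 `^ b * (dyad R k `^ (-
    b) * exits A E (dyad R k) z))%R)); last first.
  by apply/funext => k; rewrite (dintZ _ (mg k)) ?powR_ge0// (dintZ _ (me k))
      ?powR_ge0.
apply: dint_le_zsum; first exact: nnmeas_kexits.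
  by move=> k; apply: nnmeasZ => //; exact: powR_ge0.
move=> z; rewrite /kexits /exits.
set c := \1_A z.1 * \1_(~` E) (z.1 + z.2); have c0 : 0 <= c by rewrite mulr_ge0.
rewrite (@eq_zsum _ _ (fun k => (c * 2 `^ b)%:E * (dyad R k `^ (- b) * (`|z.2|
    < dyad R k)%R%:R)%:E)%E); last first.
  by move=> k; rewrite -EFinM; congr (_%:E); ring.
rewrite zsumZl; last by move=> k; rewrite lee_fin mulr_ge0 ?powR_ge0.
by rewrite [leLHS]EFinM [(c * _)%:E]EFinM -muleA lee_wpmul2l ?lee_fin// kern_le_zsum.
Qed.

Lemma zsum_exits_le b (L : R) : 0 < b -> 0 < L -> exists2 C : R, 0 < C &
  forall A E, measurable A -> measurable E -> A `<=` E ->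
  (zsum (fun k => (dyad R k `^ (- b))%:E * dint (exits A E (L * dyad R k)%R)) <=
   C%:E * dint (kexits b A E))%E.
Proof.
move=> b0 L0; have [C C0 HC] := zsum_le_kern n b0 L0.
exists C => // A E mA mE AE.
have me k : nnmeas (exits A E (L * dyad R k)) by exact: nnmeas_exits.
have mk := nnmeas_kexits b mA mE.
rewrite (_ : (fun k => _) = (fun k => dint (fun z => dyad R k `^ (- b) * exits
    A E (L * dyad R k) z)%R)); last first.
  by apply/funext => k; rewrite (dintZ _ (me k)) ?powR_ge0.
rewrite -dintZ ?(ltW C0)//; apply: zsum_le_dint.
- by apply: nnmeasZ => //; exact: ltW.
- by move=> k; apply: nnmeasZ => //; exact: powR_ge0.
move=> [x h]; rewrite /kexits /exits /=.
set c := \1_A x * \1_(~` E) (x + h); have c0 : 0 <= c by rewrite mulr_ge0.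
rewrite (@eq_zsum _ _ (fun k => c%:E * (dyad R k `^ (- b) * (`|h| < L * dyad R
    k)%R%:R)%:E)%E); last first.
  by move=> k; rewrite -EFinM; congr (_%:E); ring.
rewrite zsumZl; last by move=> k; rewrite lee_fin mulr_ge0 ?powR_ge0.
(* At the origin the dyadic sum diverges, but a null displacement cannot leave [E] from its subset
   [A], so the prefactor [c] is 0. *)
have [h0|h0] := eqVneq h 0.
  rewrite (_ : c = 0) ?mul0e ?mul0r ?mulr0//.
  rewrite /c h0 addr0 !indicE in_setC; case: (boolP (x \in A));
      last by rewrite mul0r.
  by rewrite inE => /AE Ex; rewrite mem_set//= mulr0.
by rewrite mulrCA [leRHS]EFinM lee_wpmul2l ?lee_fin// HC.
Qed.

(** Decompose the kernel over dyadic scales, compare scale by scale with [dint_exits_eball_le], and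
    resum at the dilated scales [L 2^k], which costs only a constant factor. *)
Lemma dint_kpairs_eball_le (b om : R) : (0 < n)%N -> 0 < b -> 0 < om ->
  exists2 C : R, 0 < C & forall A E r r', measurable A ->
  measurable E -> A `<=` E -> 0 < r -> 0 < r' -> mu A = (om * r ^+ n)%:E ->
  mu E = (om * r' ^+ n)%:E ->
  (dint (kpairs b (eball r) (eball r')) <= C%:E * dint (kpairs b A E))%E.
Proof.
move=> n0 b0 om0; have [C [L [C0 L0 HC]]] := dint_exits_eball_le n0 om0.
have [D D0 HD] := zsum_exits_le b0 L0.
exists (2 `^ b * C * D); first by rewrite !mulr_gt0 ?powR_gt0.
move=> A E r r' mA mE AE r0 r'0 Ar Er.
rewrite !dint_kpairs//; try exact: measurable_eball.
apply: le_trans (dint_kexits_le b0 (measurable_eball r) (measurable_eball r')) _.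
have e0 A' E' rho : (0 <= dint (exits A' E' rho))%E.
  by apply: dint_ge0 => z; rewrite !mulr_ge0.
rewrite -mulrA EFinM -muleA lee_wpmul2l ?lee_fin ?powR_ge0//.
apply: (@le_trans _ _ (zsum (fun k => C%:E *
    ((dyad R k `^ (- b))%:E * dint (exits A E (L * dyad R k)%R))))%E).
  apply: le_zsum => k; first by rewrite mule_ge0 ?lee_fin ?powR_ge0.
  rewrite muleCA lee_wpmul2l ?lee_fin ?powR_ge0//.
  by apply: HC => //; exact: dyad_gt0.
rewrite zsumZl; last by move=> k; rewrite mule_ge0 ?lee_fin ?powR_ge0.
by rewrite EFinM -muleA lee_wpmul2l ?lee_fin ?(ltW C0)// HD.
Qed.

End kernel_pairs.

(** * Layer-cake decomposition of the energy *)

Section double_series.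
Local Open Scope ereal_scope.
Variable R : realType.
Implicit Types f g : int -> nat -> \bar R.

(** The integer [j] will index dyadic level spacings, the natural number [i] the levels at a given
    spacing. *)
Definition lsum f : \bar R := zsum (fun j => \sum_(i <oo) f j i).

Lemma lsum_ge0 f : (forall j i, 0 <= f j i) -> 0 <= lsum f.
Proof. by move=> f0; apply: zsum_ge0 => j; exact: nneseries_ge0. Qed.

Lemma le_lsum f g : (forall j i, 0 <= f j i) -> (forall j i, f j i <= g j i) ->
  lsum f <= lsum g.
Proof.
move=> f0 fg; apply: le_zsum => j; first exact: nneseries_ge0.
by apply: lee_nneseries => i *.
Qed.

Lemma lsum_term f j i : (forall j i, 0 <= f j i) -> f j i <= lsum f.
Proof.
move=> f0; apply: le_trans (zsum_term j _); last by move=> k; exact: nneseries_ge0.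
apply: (@le_trans _ _ (\sum_(0 <= k < i.+1) f j k)).
  by rewrite big_nat_recr//= leeDr// sume_ge0.
by apply: nneseries_lim_ge.
Qed.

Lemma lsumZl (c : R) f : (forall j i, 0 <= f j i) ->
  lsum (fun j i => c%:E * f j i) = c%:E * lsum f.
Proof.
move=> f0; rewrite /lsum -zsumZl; last by move=> j; exact: nneseries_ge0.
by apply: eq_zsum => j; rewrite nneseriesZl.
Qed.

Lemma integral_lsum d (T : measurableType d) (mu : {measure set T -> \bar R})
    (f : int -> nat -> T -> \bar R) :
  (forall j i, measurable_fun setT (f j i)) -> (forall j i x, 0 <= f j i x) ->
  \int[mu]_x lsum (fun j i => f j i x) = lsum (fun j i => \int[mu]_x f j i x).
Proof.
move=> mf f0; rewrite /lsum integral_zsum.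
- by apply: eq_zsum => j; rewrite integral_nneseries.
- by move=> j; apply: ge0_emeasurable_sum.
- by move=> j x; exact: nneseries_ge0.
Qed.

Lemma measurable_lsum d (T : measurableType d) (f : int -> nat -> T -> \bar R) :
  (forall j i, measurable_fun setT (f j i)) -> (forall j i x, 0 <= f j i x) ->
  measurable_fun setT (fun x => lsum (fun j i => f j i x)).
Proof.
move=> mf f0; apply: measurable_zsum => [j|j x]; last exact: nneseries_ge0.
by apply: ge0_emeasurable_sum.
Qed.

End double_series.

(** * Discrete layers of an interval of values *)

Section layers.
Variable R : realType.
Implicit Types (a c p : R).

Definition step (j : int) : R := (dyad R j)^-1.

Lemma step_gt0 j : 0 < step j. Proof. by rewrite invr_gt0 dyad_gt0. Qed.

(** Take a dyadic spacing [s] with [2 s < c - a <= 4 s] and let [i] be the integer part of [a / s];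
    then [(i + 2) s <= a + 2 s < c]. *)
Lemma ex_layer a c : 0 <= a -> a < c -> exists j i,
  [/\ a < i.+1%:R * step j, i.+2%:R * step j < c & c - a <= 4 * step j].
Proof.
move=> a0 ac; have ca : 0 < c - a by rewrite subr_gt0.
have d0 : 0 < 2 / (c - a) by rewrite divr_gt0.
have [k /andP[k1 k2]] := ex_dyad d0.
pose s := step (k + 1); have s0 : 0 < s by exact: step_gt0.
have s1 : 2 * s < c - a.
  by move: k2; rewrite ltr_pdivrMr// /s /step -ltr_pdivrMl ?dyad_gt0// mulrC.
have s2 : c - a <= 4 * s.
  move: k1; rewrite ler_pdivlMr// mulrC -ler_pdivlMr ?dyad_gt0//.
  rewrite /s /step dyadS => /le_trans; apply.
  rewrite le_eqVlt; apply/orP; left; apply/eqP; field.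
  by rewrite gt_eqF// dyad_gt0.
have as0 : 0 <= a / s by rewrite divr_ge0// ltW.
have /andP[t1 t2] := truncn_itv as0.
exists (k + 1), (Num.truncn (a / s)); rewrite -/s.
move: t1 t2; rewrite ler_pdivlMr// ltr_pdivrMr// => t1 t2.
split=> //; rewrite -[_.+2]addn2 natrD mulrDl; lra.
Qed.

Lemma nneseries_telescope (f g : nat -> R) (B : R) :
  (forall i, 0 <= f i <= g i.+1 - g i) -> (forall i, g i - g 0%N <= B) ->
  (\sum_(i <oo) (f i)%:E <= B%:E)%E.
Proof.
move=> fg gB; apply: lime_le.
  by apply: is_cvg_nneseries => i _ _; rewrite lee_fin; have /andP[] := fg i.
apply: nearW => M /=; rewrite sumEFin lee_fin.
apply: (@le_trans _ _ (\sum_(0 <= i < M) (g i.+1 - g i))); last first.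
  by rewrite telescope_sumr.
by apply: ler_sum => i _; have /andP[] := fg i.
Qed.

(** Levels start at [step j] rather than 0, so that only positive superlevels enter. The weak and
    the strict inequality encode a point outside, respectively inside, a strict superlevel set. *)
Definition layer p a c j i : R :=
  step j `^ p * ((a <= i.+1%:R * step j)%R%:R * (i.+2%:R * step j < c)%R%:R).

Lemma layer_ge0 p a c j i : 0 <= layer p a c j i.
Proof. by rewrite mulr_ge0 ?powR_ge0// mulr_ge0. Qed.

Lemma layer_eq0 p a c j i : c <= a -> layer p a c j i = 0.
Proof.
move=> ca; rewrite /layer.
have [ai|] := leP a; last by rewrite mul0r mulr0.
have [ic|] := ltP; last by rewrite mulr0 mulr0.
have s0 := step_gt0 j.
move: ic; rewrite -natr1 mulrDl mul1r => ic; exfalso; lra.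
Qed.

(** At spacing [s] at most [(c - a) / s] intervals between consecutive levels fit between [a] and
    [c], each worth [s^p], and none fits unless [s < c - a]. *)
Lemma layer_sum_le p a c j : a < c ->
  (\sum_(i <oo) (layer p a c j i)%:E <=
   ((c - a) * (dyad R j `^ (- (p - 1)) * ((c - a)^-1 < dyad R j)%R%:R))%:E)%E.
Proof.
move=> ac; have ca : 0 < c - a by rewrite subr_gt0.
have s0 := step_gt0 j; have d0 := dyad_gt0 R j.
have sp : step j `^ p = dyad R j `^ (- (p - 1)) * step j.
  rewrite {1}/step -powR_inv1 ?ltW// -powRrM mulN1r (_ : - p = - (p - 1) + -
      1); last by ring.
  by rewrite powRD ?[dyad R j == 0]gt_eqF ?implybT// powR_inv1// ltW.
have [cd|dc] := ltP (c - a)^-1 (dyad R j); last first.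
  rewrite !mulr0 eseries0// => i _ _; rewrite /layer.
  have [ai|] := leP a; last by rewrite mul0r mulr0.
  have [ic|] := ltP; last by rewrite mulr0 mulr0.
  have cas : c - a <= step j by rewrite -(invrK (c - a)) lef_pV2 ?posrE ?invr_gt0.
  move: ic; rewrite -[_.+2%:R]natr1 mulrDl mul1r => ic; exfalso; lra.
rewrite mulr1.
(* Clamping the levels to [[a, c]] makes the sum telescope: a counted interval contributes its full
   length, and the total increase is at most [c - a]. *)
pose clamp (i : nat) := Num.min (Num.max (i.+1%:R * step j) a) c.
have clampS i : clamp i <= clamp i.+1.
  have h : i.+1%:R * step j <= i.+2%:R * step j by rewrite ler_wpM2r ?ler_nat// ltW.
  rewrite /clamp; apply: le_min2 => //; exact: le_max2.
apply: (@nneseries_telescope _ (fun i => dyad R j `^ (- (p - 1)) * clamp i)).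
- move=> i; rewrite layer_ge0 /layer sp -mulrA -mulrBr ler_wpM2l ?powR_ge0//.
  have [ai|] := leP a; last by rewrite mul0r mulr0 subr_ge0.
  have [ic|] := ltP; last by rewrite mulr0 mulr0 subr_ge0.
  have h : i.+1%:R * step j <= i.+2%:R * step j by rewrite ler_wpM2r ?ler_nat// ltW.
  rewrite /clamp !max_l ?(le_trans ai h)// !min_l ?(le_trans h (ltW ic)) ?(ltW ic)//.
  rewrite !mulr1 -[i.+2%:R]natr1 mulrDl mul1r; lra.
- move=> i; rewrite -mulrBr mulrC ler_wpM2r ?powR_ge0//.
  rewrite lerB//; first by rewrite ge_min lexx orbT.
  by rewrite le_min le_max lexx orbT/= ltW.
Qed.

(** For [a < c] it remains to sum [s^(p-1)] over the dyadic [s < c - a], a geometric series because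
    [p > 1], bounded by a multiple of [(c - a)^(p-1)]. *)
Lemma lsum_layer_le p : 1 < p -> exists2 C : R, 0 < C & forall a c,
  (lsum (fun j i => (layer p a c j i)%:E) <= (C * `|c - a| `^ p)%:E)%E.
Proof.
move=> p1; have p10 : 0 < p - 1 by rewrite subr_gt0.
pose K : R := (1 - 2 `^ (- (p - 1)))^-1.
have K0 : 0 < K by exact: geometric_const_gt0.
exists K => // a c; have [ac|ca] := ltP a c; last first.
  rewrite (_ : (fun _ => _) = (fun j i => 0%:E * (layer p a c j i)%:E)%E);
      last first.
    by apply/funext => j; apply/funext => i; rewrite layer_eq0// mule0.
  rewrite lsumZl; last by move=> j i; rewrite lee_fin layer_ge0.
  by rewrite mul0e lee_fin mulr_ge0 ?powR_ge0 ?ltW.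
have l0 : 0 < c - a by rewrite subr_gt0.
have li0 : 0 < (c - a)^-1 by rewrite invr_gt0.
apply: (@le_trans _ _ (zsum (fun j => (c - a)%:E *
    (dyad R j `^ (- (p - 1)) * ((c - a)^-1 < dyad R j)%R%:R)%:E))%E).
  apply: le_zsum => j.
    by apply: nneseries_ge0 => i _ _; rewrite lee_fin layer_ge0.
  by rewrite -EFinM; exact: layer_sum_le.
rewrite zsumZl; last by move=> j; rewrite lee_fin mulr_ge0 ?powR_ge0.
apply: (@le_trans _ _ ((c - a)%:E * (K * (c - a)^-1 `^ (- (p - 1)))%:E)%E).
  by rewrite lee_wpmul2l ?lee_fin ?(ltW l0)// zsum_geometric.
rewrite -EFinM lee_fin (gtr0_norm l0) mulrCA ler_pM2l//.
rewrite -powR_inv1 ?(ltW l0)// -powRrM mulrNN mul1r.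
rewrite -{1}(powRr1 (ltW l0)) -powRD ?[c - a == 0]gt_eqF ?implybT//.
by rewrite [1 + _]addrC subrK.
Qed.

End layers.

(** * Energy as a sum over layers *)

Section layered_energy.
Variables (R : realType) (n : nat).
Local Notation V := 'rV[R]_n.
Implicit Types (f : V * V -> R) (u w : V -> R).

Lemma dint_le_lsum f (g : int -> nat -> V * V -> R) : nnmeas f ->
  (forall j i, nnmeas (g j i)) ->
  (forall z, (f z)%:E <= lsum (fun j i => (g j i z)%:E))%E ->
  (dint f <= lsum (fun j i => dint (g j i)))%E.
Proof.
move=> [mf f0] mg fg; rewrite unlock.
have mg' j i : measurable_fun setT (fun z => (g j i z)%:E).
  by apply/measurable_EFinP; case: (mg j i).
have g0 j i z : (0 <= (g j i z)%:E)%E by rewrite lee_fin; case: (mg j i).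
rewrite -integral_lsum//; apply: ge0_le_integral => //.
- by move=> z _; rewrite lee_fin.
- exact/measurable_EFinP.
- exact: measurable_lsum.
Qed.

Lemma lsum_le_dint f (g : int -> nat -> V * V -> R) : nnmeas f ->
  (forall j i, nnmeas (g j i)) ->
  (forall z, lsum (fun j i => (g j i z)%:E) <= (f z)%:E)%E ->
  (lsum (fun j i => dint (g j i)) <= dint f)%E.
Proof.
move=> [mf f0] mg fg; rewrite unlock.
have mg' j i : measurable_fun setT (fun z => (g j i z)%:E).
  by apply/measurable_EFinP; case: (mg j i).
have g0 j i z : (0 <= (g j i z)%:E)%E by rewrite lee_fin; case: (mg j i).
rewrite -integral_lsum//; apply: ge0_le_integral => //.
- by move=> z _; exact: lsum_ge0.
- exact: measurable_lsum.
- exact/measurable_EFinP.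
Qed.

Lemma dint_symmetrize f : nnmeas f ->
  dint (fun z => f z + f (z.2, z.1)) = (2%:E * dint f)%E.
Proof.
move=> mf; rewrite (dintD mf (nnmeas_comp mf (@measurable_swap _ _ _ _))).
rewrite (dint_swap mf) -[2]/(1 + 1) EFinD ge0_muleDl ?lee_fin// mul1e.
by [].
Qed.

(** Stated for a family of sets instead of a function, so as to cover both superlevel sets and their
    rearrangements. *)
Definition layer_energy (b p : R) (A : R -> set V) : \bar R :=
  lsum (fun j i => ((step R j `^ p)%:E *
    dint (kpairs b (A (i.+2%:R * step R j)%R) (A (i.+1%:R * step R j)%R)))%E).

(** At a pair [(x, y)] the layers sum to the kernel times the sum of [layer p (u y) (u x)], so
    [lsum_layer_le] applies pointwise. *)
Lemma layer_energy_le (b p : R) : 1 < p -> exists2 C : R, 0 < C &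
  forall u, measurable_fun setT u ->
  (layer_energy b p (fun t => [set x | (t < u x)%R]) <= C%:E * dint (diff_quot
      b p u))%E.
Proof.
move=> p1; have [C C0 HC] := lsum_layer_le p1.
exists C => // u mu'; pose A t := [set x : V | t < u x].
have mA t : measurable (A t) by exact: measurable_superlevel.
pose g j i z := step R j `^ p * kpairs b (A (i.+2%:R * step R j)) (A (i.+1%:R *
    step R j)) z.
have mk j i : nnmeas (kpairs b (A (i.+2%:R * step R j)) (A (i.+1%:R * step R j))).
  exact: nnmeas_kpairs.
have mg j i : nnmeas (g j i) by apply: nnmeasZ => //; exact: powR_ge0.
have md := nnmeas_diff_quot b p mu'.
rewrite /layer_energy (_ : (fun j => _) = (fun j i => dint (g j i))); last first.
  by apply/funext => j; apply/funext => i; rewrite (dintZ _ (mk j i)) ?powR_ge0.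
rewrite -dintZ ?(ltW C0)//; apply: lsum_le_dint => //.
  by apply: nnmeasZ => //; exact: ltW.
move=> [x y]; rewrite /g /kpairs /diff_quot /=.
have : 0 <= kern b (x - y) by exact: kern_ge0.
move: (kern b (x - y)) => k k0.
rewrite (_ : (fun j => _) = (fun j i => k%:E * (layer p (u y) (u x) j
    i)%:E)%E); last first.
  apply/funext => j; apply/funext => i; rewrite -EFinM; congr (_%:E).
  have -> : \1_(A (i.+2%:R * step R j)) x = (i.+2%:R * step R j < u x)%R%:R :> R.
    by rewrite indicE; congr (nat_of_bool _)%:R; apply/idP/idP; rewrite inE.
  have -> : \1_(~` A (i.+1%:R * step R j)) y = (u y <= i.+1%:R * step R j)%R%:R :> R.
    rewrite indicE in_setC leNgt; congr (nat_of_bool (~~ _))%:R.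
    by apply/idP/idP; rewrite inE.
  by rewrite /layer; ring.
rewrite lsumZl; last by move=> j i; rewrite lee_fin layer_ge0.
by rewrite mulrA [leRHS]EFinM muleC lee_wpmul2r ?lee_fin.
Qed.

(** For [t > 0], [B t] lies between [{w > t}] and [{w >= t}]. A pair with [w y < w x] is captured by
    the single layer of [ex_layer], where [w x - w y <= 4 step j]: hence [4^p]. The factor 2 covers
    the opposite orientation. *)
Lemma layer_energy_ge (b p : R) : exists2 C : R, 0 < C &
  forall w (B : R -> set V), measurable_fun setT w -> (forall x, 0 <= w x) ->
  (forall t, measurable (B t)) ->
  (forall x t, 0 < t -> t < w x -> B t x) ->
  (forall x t, 0 < t -> B t x -> t <= w x) -> 0 < p ->
  (dint (diff_quot b p w) <= C%:E * layer_energy b p B)%E.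
Proof.
exists (2 * 4 `^ p); first by rewrite mulr_gt0// powR_gt0.
move=> w B mw w0 mB Bsub Bsup p0.
pose K j i := kpairs b (B (i.+2%:R * step R j)) (B (i.+1%:R * step R j)).
have mK j i : nnmeas (K j i) by exact: nnmeas_kpairs.
have mKs j i : nnmeas (fun z => K j i (z.2, z.1)) := nnmeas_comp (mK j i)
    (@measurable_swap _ _ _ _).
have c0 j : 0 <= 4 `^ p * step R j `^ p by rewrite mulr_ge0 ?powR_ge0.
pose g j i z := 4 `^ p * step R j `^ p * (K j i z + K j i (z.2, z.1)).
have mg j i : nnmeas (g j i) by apply: nnmeasZ => //; exact: nnmeasD.
have gE j i : dint (g j i) = ((2 * 4 `^ p)%:E * ((step R j `^ p)%:E * dint (K j
    i)))%E.
  rewrite (dintZ (c0 j) (nnmeasD (mK j i) (mKs j i))) (dint_symmetrize (mK j i)).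
  by rewrite !muleA -!EFinM; congr (_%:E * _)%E; ring.
have K0 j i : (0 <= (step R j `^ p)%:E * dint (K j i))%E.
  by rewrite mule_ge0 ?lee_fin ?powR_ge0//; apply: dint_ge0; case: (mK j i).
rewrite /layer_energy -lsumZl//.
rewrite (_ : (fun j => _) = (fun j i => dint (g j i))); last first.
  by apply/funext => j; apply/funext => i; rewrite gE.
apply: dint_le_lsum => //; first exact: nnmeas_diff_quot.
have key x y : w y < w x -> exists j i,
    `|w x - w y| `^ p * kern b (x - y) <= 4 `^ p * step R j `^ p * K j i (x, y).
  move=> wyx; have [j [i [h1 h2 h3]]] := ex_layer (w0 y) wyx.
  have s0 := step_gt0 R j.
  exists j, i; rewrite /K /kpairs /= !indicE in_setC mem_set; last first.
    by apply: Bsub => //; rewrite mulr_gt0.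
  rewrite memNset; last first.
    by move=> /Bsup; rewrite leNgt h1 => /(_ (mulr_gt0 (ltr0Sn _ _) s0)).
  rewrite !mul1r ler_wpM2r ?kern_ge0// -powRM ?(ltW s0)//.
  rewrite gtr0_norm ?subr_gt0//; apply: ge0_ler_powR => //; rewrite ?nnegrE.
  - exact: ltW.
  - by rewrite subr_ge0 ltW.
  - by rewrite mulr_ge0// ltW.
have g0 j i z : (0 <= (g j i z)%:E)%E by rewrite lee_fin; case: (mg j i).
have Kz j i z : 0 <= K j i z by case: (mK j i).
move=> [x y]; rewrite /diff_quot /=.
have [xy|yx|->] := ltgtP (w x) (w y); last first.
- rewrite subrr normr0 powR0 ?gt_eqF// mul0r; exact: lsum_ge0.
- have [j [i H]] := key x y yx.
  apply: (le_trans _ (lsum_term j i (fun j i => g0 j i (x, y)))).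
  rewrite lee_fin; apply: (le_trans H); rewrite /g /=; move: (Kz j i (y, x)).
  by move: (K j i (x, y)) (K j i (y, x)) => k1 k2 k20; rewrite ler_wpM2l// lerDl.
- have [j [i H]] := key y x xy.
  apply: (le_trans _ (lsum_term j i (fun j i => g0 j i (x, y)))).
  rewrite lee_fin distrC -kernN opprB; apply: (le_trans H).
  rewrite /g /=; move: (Kz j i (x, y)).
  by move: (K j i (x, y)) (K j i (y, x)) => k1 k2 k10; rewrite ler_wpM2l// lerDr.
Qed.

End layered_energy.

(** * Rearrangement *)

Section rearrangement_facts.
Variables (R : realType) (n : nat).
Local Notation V := 'rV[R]_n.
Local Notation mu := (lebesgue_rV R n).
Implicit Types (A D : set V) (u : V -> R).

Lemma unit_ball_volume_ge0 : 0 <= unit_ball_volume R n.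
Proof.
rewrite divr_ge0 ?powR_ge0//; apply: fine_ge0; apply: integral_ge0 => t _.
by rewrite lee_fin mulr_ge0 ?powR_ge0 ?expR_ge0.
Qed.

Lemma symm_set_eball A : (mu A < +oo)%E ->
  symm_set A = eball ((fine (mu A) / unit_ball_volume R n) `^ n%:R^-1).
Proof. by move=> Aoo; rewrite /symm_set lt_eqF. Qed.

Lemma measurable_symm_set A : measurable (symm_set A).
Proof.
have [Aoo|/symm_set_eball ->] := leP +oo%E (mu A); last exact: measurable_eball.
by rewrite /symm_set (_ : _ == _)// -leye_eq.
Qed.

Lemma symm_set_subset A D : measurable A -> measurable D -> A `<=` D ->
  (mu D < +oo)%E -> symm_set A `<=` symm_set D.
Proof.
move=> mA mD AD Doo.
have AD' : (mu A <= mu D)%E by rewrite le_measure ?inE.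
have Aoo := le_lt_trans AD' Doo.
rewrite !symm_set_eball// => x /lt_le_trans; apply.
have pos E : 0 <= fine (mu E) / unit_ball_volume R n.
  by rewrite divr_ge0 ?fine_ge0 ?unit_ball_volume_ge0.
apply: ge0_ler_powR; rewrite ?nnegrE ?pos ?invr_ge0//.
rewrite ler_wpM2r ?invr_ge0 ?unit_ball_volume_ge0// fine_le// ge0_fin_numE//.
Qed.

Lemma symm_set_null A : (0 < n)%N ->
  mu A = 0%E \/ unit_ball_volume R n = 0 -> (mu A < +oo)%E -> symm_set A = set0.
Proof.
move=> n0 A0 Aoo; rewrite symm_set_eball//.
(* Division by 0 yields 0, and 0 to the nonzero power [1/n] is 0, so the ball has radius 0. *)
rewrite (_ : _ / _ = 0); last by case: A0 => ->; rewrite ?mul0r ?invr0 ?mulr0.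
rewrite powR0 ?invr_eq0 ?pnatr_eq0 -?lt0n//.
apply/seteqP; split => x //; rewrite /eball /= => x0.
by have := lt_le_trans x0 (enorm_ge0 x); rewrite ltxx.
Qed.

(** Solves the radius formula for [|A|], the form in which [dint_kpairs_eball_le] takes its sets. *)
Lemma symm_set_volume A : (0 < n)%N -> (mu A < +oo)%E -> (0 < mu A)%E ->
  0 < unit_ball_volume R n -> exists2 r : R, 0 < r &
  symm_set A = eball r /\ mu A = (unit_ball_volume R n * r ^+ n)%:E.
Proof.
move=> n0 Aoo A0 om0; rewrite symm_set_eball//.
have fA : mu A \is a fin_num by rewrite ge0_fin_numE.
have a0 : 0 < fine (mu A) by rewrite fine_gt0// A0 Aoo.
exists ((fine (mu A) / unit_ball_volume R n) `^ n%:R^-1).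
  by apply: powR_gt0; exact: divr_gt0.
split => //; rewrite -powR_mulrn ?powR_ge0// -powRrM mulVf ?pnatr_eq0 -?lt0n//.
have q0 : 0 <= fine (mu A) / unit_ball_volume R n by apply: divr_ge0; exact: ltW.
by rewrite powRr1// mulrCA mulfV ?gt_eqF// mulr1 fineK.
Qed.

Section superlevel.
Variables (u : V -> R) (M : R).
Hypotheses (n0 : (0 < n)%N) (mu' : measurable_fun setT u).
Hypotheses (u0 : forall x, 0 <= u x) (M0 : 0 < M) (uM : forall x, u x <= M).
Hypothesis finu : forall t, 0 < t -> (mu [set x | (t < u x)%R] < +oo)%E.

Let A t := [set x : V | (t < u x)%R].
Let B t := symm_set (A t).

Let mA t : measurable (A t). Proof. exact: measurable_superlevel. Qed.

Let BS s t : 0 < s -> s <= t -> B t `<=` B s.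
Proof.
move=> s0 st; apply: symm_set_subset => //; last exact: finu.
by move=> x; exact: le_lt_trans.
Qed.

Let BM t : M <= t -> B t = set0.
Proof.
move=> Mt; have A0 : A t = set0.
  by apply/seteqP; split => x //; rewrite /A /= ltNge (le_trans (uM x) Mt).
by apply: symm_set_null => //; rewrite A0 measure0 ?ltry//; left.
Qed.

Let T x := [set t : R | 0 < t /\ B t x].

(** The sets [B t] decrease in [t], so the levels [t] with [x] in [B t] form an interval. *)
Let mT x : measurable (T x).
Proof.
apply: is_interval_measurable => a b [a0 Ba] [b0 Bb] t /andP[at_ tb].
by have t0 := lt_le_trans a0 at_; split => //; exact: BS t0 tb _ Bb.
Qed.

Let symm_funE x : symm_fun u x = fine (lebesgue_measure (T x)).
Proof.
rewrite /symm_fun /Rintegral; congr fine.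
transitivity (\int[lebesgue_measure]_(t in `]0%R, +oo[) (\1_(T x) t)%:E)%E.
  apply: eq_integral => t; rewrite inE /= in_itv/= andbT => t0.
  rewrite (_ : [set y | _] = A t); last first.
    by apply/seteqP; split => y /=; rewrite ger0_norm.
  rewrite !indicE; congr (nat_of_bool _)%:R%:E.
  by apply/idP/idP; rewrite !inE; [split|case].
rewrite integral_indic//; last exact: mT.
congr (lebesgue_measure _).
by apply/seteqP; split => t; [move=> []|move=> Tt; split=> //=;
    rewrite in_itv/= andbT; case: Tt].
Qed.

Let T_itv x t (b : bool) : T x `<=` [set` Interval (BRight 0) (BSide b t)] -> 0
    < t ->
  (lebesgue_measure (T x) <= t%:E)%E.
Proof.
move=> Tt t0; apply: (@le_trans _ _ (lebesgue_measure [set` Interval (BRight 0)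
    (BSide b t)])).
  by apply: le_measure => //; rewrite inE; [exact: mT|exact: measurable_itv].
by rewrite lebesgue_measure_itv/= lte_fin t0 sube0.
Qed.

Let T_fin x : lebesgue_measure (T x) \is a fin_num.
Proof.
rewrite ge0_fin_numE//; apply: (@le_lt_trans _ _ M%:E); last exact: ltry.
apply: (@T_itv x M true) => // t [t0 Bt] /=; rewrite in_itv/= t0/= ltNge.
by apply/negP => Mt; move: Bt; rewrite BM.
Qed.

Lemma symm_fun_ge0 x : 0 <= symm_fun u x.
Proof. by rewrite symm_funE fine_ge0. Qed.

(** If [x] is not in [B t], all of [T x] lies below [t] and has length at most [t]. With
    [symm_fun_sup] this places [B t] between the strict and the weak superlevel set of
    [symm_fun u]. *)
Lemma symm_fun_sub x t : 0 < t -> t < symm_fun u x -> B t x.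
Proof.
move=> t0; apply: contraPP => nB; apply/negP; rewrite -leNgt symm_funE.
rewrite -lee_fin fineK//; apply: (@T_itv x t true) => // s [s0 Bs] /=.
rewrite in_itv/= s0/= ltNge; apply/negP => ts; apply: nB; exact: (BS t0 ts).
Qed.

Lemma symm_fun_sup x t : 0 < t -> B t x -> t <= symm_fun u x.
Proof.
move=> t0 Bt; rewrite symm_funE -lee_fin fineK//.
apply: (@le_trans _ _ (lebesgue_measure `]0, t]%classic)).
  by rewrite lebesgue_measure_itv/= lte_fin t0 sube0.
apply: le_measure; rewrite ?inE; [exact: measurable_itv|exact: mT|].
move=> s /=; rewrite in_itv/= => /andP[s0 st].
by split => //; exact: (BS s0 st).
Qed.

Lemma measurable_symm_fun : measurable_fun setT (symm_fun u).
Proof.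
apply: (measurability _ (RGenOInfty.measurableE R)) => _ [_ [a ->] <-];
    rewrite setTI.
have [a0|a0] := ltP a 0.
  rewrite (_ : _ @^-1` _ = setT); first exact: measurableT.
  apply/seteqP; split => x //= _; rewrite in_itv/= andbT.
  exact: lt_le_trans (symm_fun_ge0 x).
(* As [B t] is only located between the strict and the weak superlevel set, levels decreasing to [a]
   are used; they stay positive when [a] is 0. *)
rewrite (_ : _ @^-1` _ = \bigcup_k B (a + k.+1%:R^-1)).
  by apply: bigcupT_measurable => k; exact: measurable_symm_set.
have a1 k : 0 < a + k.+1%:R^-1 by rewrite ltr_wpDl.
apply/seteqP; split => x /=; rewrite in_itv/= andbT.
  move=> ax; have e0 : 0 < symm_fun u x - a by rewrite subr_gt0.
  have [k ke] : exists k : nat, k.+1%:R^-1 < symm_fun u x - a.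
    exact: filter_ex (near_infty_natSinv_lt (PosNum e0)).
  by exists k => //; apply: symm_fun_sub => //; rewrite -ltrBrDl.
move=> [k _ Bk]; apply: lt_le_trans (symm_fun_sup (a1 k) Bk).
by rewrite ltrDl.
Qed.

End superlevel.
End rearrangement_facts.

(** * Energy of the rearranged function on the whole space *)

Section symmetrization.
Variables (R : realType) (n : nat).
Local Notation V := 'rV[R]_n.
Local Notation mu := (lebesgue_rV R n).
Implicit Types (A E D : set V) (u : V -> R).

Lemma gagliardo_dint (s p : R) D u :
  gagliardo s p D u = dint (regional_quot (n%:R + s * p) p D u).
Proof.
rewrite /gagliardo integral_mkcond unlock; apply: eq_integral => -[x y] _.
rewrite patchE /regional_quot /diff_quot /kern powRN !indicE.
have -> : ((x, y) \in D `*` D) = (x \in D) && (y \in D).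
  by apply/idP/andP; rewrite !inE.
by case: (x \in D); case: (y \in D) => /=; rewrite ?mul0r ?mulr0 ?mul0r ?mul1r.
Qed.

Lemma regional_quotT (b p : R) u : regional_quot b p setT u = diff_quot b p u.
Proof. by apply/funext => z; rewrite /regional_quot !indicT !mul1r. Qed.

Lemma dint_kpairs0 (b : R) E : measurable E -> dint (kpairs b set0 E) = 0%E.
Proof.
move=> mE; rewrite (_ : kpairs _ _ _ = fun z => 0 * kpairs b set0 E z).
  by rewrite (dintZ _ (nnmeas_kpairs b _ mE)) ?mul0e.
by apply/funext => z; rewrite /kpairs indic0 !mul0r.
Qed.

(** If [mu A] or [unit_ball_volume] is 0, [symm_set A] is empty and the left-hand side vanishes.
    Otherwise both rearrangements are balls, compared with [om] equal to [unit_ball_volume]. *)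
Lemma dint_kpairs_symm_le (b : R) : (0 < n)%N -> 0 < b ->
  exists2 C : R, 0 < C & forall A E, measurable A -> measurable E ->
  A `<=` E -> (mu E < +oo)%E ->
  (dint (kpairs b (symm_set A) (symm_set E)) <= C%:E * dint (kpairs b A E))%E.
Proof.
move=> n0 b0; have K0 A E : (0 <= dint (kpairs b A E))%E.
  by apply: dint_ge0 => z; rewrite !mulr_ge0 ?kern_ge0.
have := @unit_ball_volume_ge0 R n; rewrite le_eqVlt => /orP[/eqP om0|om0].
  exists 1 => // A E mA mE AE Eoo; rewrite symm_set_null//; last 2 first.
  - by right.
  - by apply: le_lt_trans Eoo; rewrite le_measure ?inE.
  by rewrite dint_kpairs0 ?mul1e//; exact: measurable_symm_set.
have [C C0 HC] := dint_kpairs_eball_le n0 b0 om0.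
exists C => // A E mA mE AE Eoo.
have AE' : (mu A <= mu E)%E by rewrite le_measure ?inE.
have Aoo := le_lt_trans AE' Eoo.
have [A0|A0] := eqVneq (mu A) 0%E.
  rewrite symm_set_null//; last by left.
  rewrite dint_kpairs0; last exact: measurable_symm_set.
  by rewrite mule_ge0// lee_fin ltW.
have {}A0 : (0 < mu A)%E by rewrite lt_neqAle eq_sym A0 measure_ge0.
have [r r0 [-> Ar]] := symm_set_volume n0 Aoo A0 om0.
have [r' r'0 [-> Er]] := symm_set_volume n0 Eoo (lt_le_trans A0 AE') om0.
exact: HC.
Qed.

(** The energy of [symm_fun u] is bounded by the layer energy of the rearranged superlevel sets,
    this one layer by layer by that of the original sets, and the latter by the energy of [u]. *)
Lemma dint_diff_quot_symm_le (b p : R) : (0 < n)%N -> 0 < b -> 1 < p ->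
  exists2 C : R, 0 < C & forall u M, measurable_fun setT u ->
  (forall x, 0 <= u x) -> 0 < M -> (forall x, u x <= M) ->
  (forall t, 0 < t -> (mu [set x | (t < u x)%R] < +oo)%E) ->
  (dint (diff_quot b p (symm_fun u)) <= C%:E * dint (diff_quot b p u))%E.
Proof.
move=> n0 b0 p1; have p0 : 0 < p by exact: lt_trans p1.
have [C1 C10 H1] := @layer_energy_le R n b p p1.
have [C2 C20 H2] := @layer_energy_ge R n b p.
have [C3 C30 H3] := dint_kpairs_symm_le n0 b0.
exists (C2 * (C3 * C1)); first by rewrite !mulr_gt0.
move=> u M mu' u0 M0 uM finu.
pose A t := [set x : V | t < u x].
have mA t : measurable (A t) by exact: measurable_superlevel.
have K0 A' E' : (0 <= dint (kpairs b A' E'))%E.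
  by apply: dint_ge0 => z; rewrite !mulr_ge0 ?kern_ge0.
have step2 := H2 (symm_fun u) (fun t => symm_set (A t))
  (measurable_symm_fun n0 mu' u0 M0 uM finu)
  (symm_fun_ge0 mu' u0 finu) (fun t => measurable_symm_set (A t))
  (symm_fun_sub n0 mu' u0 M0 uM finu) (symm_fun_sup n0 mu' u0 M0 uM finu) p0.
apply: (le_trans step2).
rewrite EFinM -muleA lee_wpmul2l ?lee_fin ?(ltW C20)//.
apply: (@le_trans _ _ (C3%:E * layer_energy b p A)%E); last first.
  by rewrite EFinM -muleA lee_wpmul2l ?lee_fin ?(ltW C30)// H1.
rewrite /layer_energy -lsumZl; last first.
  by move=> j i; rewrite mule_ge0 ?lee_fin ?powR_ge0.
apply: le_lsum => j i; first by rewrite mule_ge0 ?lee_fin ?powR_ge0.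
have s0 := step_gt0 R j.
rewrite muleCA lee_wpmul2l ?lee_fin ?powR_ge0//; apply: H3 => //.
- move=> x; apply: le_lt_trans; rewrite ler_pM2r// ler_nat//.
- by apply: finu; rewrite mulr_gt0.
Qed.

End symmetrization.

(** * Combination of the domain bound with the rearrangement bound *)

Theorem theorem1p2 (R : realType) (n : nat) (sigma p : R)
    (hn : (1 <= n)%N) (hsigma0 : 0 < sigma) (hsigma1 : sigma < 1)
    (hp : 0 < p) (hsp : 1 < sigma * p) :
  exists2 C : R, 0 < C &
    forall Omega : set 'rV[R]_n, open Omega ->
    forall u : 'rV[R]_n -> R, Cc_smooth Omega u -> (forall x, 0 <= u x) ->
      (gagliardo sigma p [set: 'rV[R]_n] (symm_fun u)
         <= C%:E * gagliardo sigma p Omega u)%E /\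
      (gagliardo sigma p (symm_set Omega) (symm_fun u)
         <= C%:E * gagliardo sigma p Omega u)%E.
Proof.
(* The layer decomposition requires [p > 1], which [sigma < 1] and [sigma p > 1] force. *)
have p1 : 1 < p by apply: (lt_trans hsp); rewrite gtr_pMl.
have b0 : 0 < n%:R + sigma * p by rewrite ltr_wpDl// mulr_gt0.
have [C1 C10 H1] := @regional_hardy R n _ _ hsp hp.
have [C2 C20 H2] := dint_diff_quot_symm_le hn b0 p1.
exists (C2 * C1); first by rewrite mulr_gt0.
move=> Omega oO u [su cK KO] u0.
(* The empty list of partial derivatives in [smooth] stands for [u] itself. *)
have cu : continuous u := (su [::]).1.
have mu' : measurable_fun setT u by exact: continuous_measurable_rV.
have uK x : ~ closure [set x | u x != 0] x -> u x = 0.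
  by move=> Kx; apply/eqP; apply: contrapT => /negP ux; apply: Kx;
      exact: subset_closure.
have [L L0 HL] := compact_normr_lt cK.
have [M M0 HM] := compact_continuous_le cK cu.
have uM x : u x <= M.
  have [/HM//|/uK ->] := pselect (closure [set x | u x != 0] x); exact: ltW.
(* Superlevel sets at positive levels lie in the support, hence in a cube. *)
have finu t : 0 < t -> (lebesgue_rV R n [set x | (t < u x)%R] < +oo)%E.
  move=> t0; apply: (@le_lt_trans _ _ (lebesgue_rV R n [set x | `|x| < L]));
      last first.
    by rewrite lebesgue_rV_cube// ltry.
  apply: le_measure; rewrite ?inE.
  - exact: measurable_superlevel.
  - exact: measurable_cube.
  - move=> x /= tx; apply: HL; apply: contrapT => /uK ux.
    by move: tx; rewrite ux ltNge ltW.
have msf := measurable_symm_fun hn mu' u0 M0 uM finu.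
have mq := nnmeas_diff_quot (n%:R + sigma * p) p msf.
have full : (dint (diff_quot (n%:R + sigma * p) p (symm_fun u)) <=
    (C2 * C1)%:E * gagliardo sigma p Omega u)%E.
  apply: (le_trans (H2 u M mu' u0 M0 uM finu)).
  rewrite EFinM -muleA lee_wpmul2l ?lee_fin ?(ltW C20)//.
  rewrite gagliardo_dint; exact: H1.
split; first by rewrite [leLHS]gagliardo_dint regional_quotT.
(* Restricting a nonnegative integrand to pairs in [symm_set Omega] only decreases its integral. *)
apply: le_trans full; rewrite gagliardo_dint; apply: le_dint => //.
  apply: nnmeasM; last exact: nnmeas_diff_quot.
  by apply: nnmeasM; apply: nnmeas_indic => //; exact: measurable_symm_set.
by move=> z; rewrite /regional_quot ler_piMl//; case: mq.
Qed.
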